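(* Let $X$ be a real Banach space and let $(e_n,e_n^* )_{n\in\mathbb N}$ in $X\times X^*$ be a shrinking Schauder basis of $X$. Assume that $\sum_{i=1}^ne_i$ converges weak$^*$ in $X^{**}$ to some $e\in X^{**}$ as $n\to\infty$. Let $A:X^*\rightrightarrows X^{**}$ be defined by $$\operatorname{gra}A=\Big\{(y^*,y^{**})\in X^*\times X^{**}\ \Big|\ \sum_{n=1}^k\big(\sum_{i>n}\langle e_i,y^*\rangle-\sum_{i<n}\langle e_i,y^*\rangle\big)e_n\ \text{converges weak}^*\text{ to }y^{**}\text{ as }k\to\infty\Big\}.$$ Then $A$ is a maximally monotone and linear skew operator, which is of type (BR). In particular, let $X=\mathbf J$ be the James space, let $e_n=(0,\dots,0,1,0,\dots)$ (the $n$th entry is $1$, the others $0$) and $e=(1,1,\dots,1,\dots)\in\mathbf J^{**}$. Then, with $A:\mathbf J^*\rightrightarrows\mathbf J^{**}$ given by $$\operatorname{gra}A=\Big\{(y^*,y^{**})\in \mathbf J^*\times \mathbf J^{**}\ \Big|\ \sum_{n=1}^k\big(\sum_{i>n}\langle e_i,y^*\rangle-\sum_{i<n}\langle e_i,y^*\rangle\big)e_n\ \text{converges weak}^*\text{ to }y^{**}\text{ as }k\to\infty\Big\},$$ $A+\langle\cdot,e\rangle e$ is a maximally monotone operator that is neither of type (D) nor unique; and every Banach space containing an (isomorphic) copy of $\mathbf J^*$ is not of type (D).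
   Context: All Banach spaces are real; a Banach space $Z$ is identified with its canonical image in $Z^{**}$, and $\langle\cdot,\cdot\rangle$ denotes duality pairings (arguments in either order). $\mathbb N=\{1,2,\dots\}$. $(e_n,e_n^* )_{n\in\mathbb N}$ in $X\times X^*$ is a Schauder basis of $X$ if for every $x\in X$ there is a unique real sequence $(\alpha_n)$ with $x=\sum_{n\ge1}\alpha_ne_n$, where $\alpha_n=\langle x,e_n^*\rangle$ and $\langle e_i,e_j^*\rangle=\delta_{i,j}$; it is shrinking if $\overline{\operatorname{span}\{e_n^*\mid n\in\mathbb N\}}=X^*$. The James space $\mathbf J$ consists of all sequences $x=(x_n)_{n\in\mathbb N}$ in $c_0$ with finite norm $$\|x\|:=\sup_{n_1<\cdots<n_k}\big((x_{n_1}-x_{n_2})^2+\cdots+(x_{n_{k-1}}-x_{n_k})^2\big)^{1/2}.$$ It is a known fact that $(e_n)$ with its coordinate functionals $e_n^*$ is a shrinking Schauder basis of $\mathbf J$ and $\mathbf J^{**}=\mathbf J\oplus\operatorname{span}\{e\}$, where $e=(1,1,\dots)$ is the element of $\mathbf J^{**}$ with $\langle e,e_n^*\rangle=1$ for all $n$. The following definitions, for a general Banach space $Z$, are applied with $Z=X^*$. A set-valued operator $B:Z\rightrightarrows Z^*$ has graph $\operatorname{gra}B=\{(x,x^* )\mid x^*\in Bx\}$. It is monotone if $\langle x-y,x^*-y^*\rangle\ge0$ for all $(x,x^* ),(y,y^* )\in\operatorname{gra}B$, maximally monotone if moreover it has no proper monotone extension (graph inclusion), linear (a linear relation) if $\operatorname{gra}B$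 is a linear subspace, and skew if $\langle x,x^*\rangle=0$ for all $(x,x^* )\in\operatorname{gra}B$. A maximally monotone $B:Z\rightrightarrows Z^*$ is: - of type (D) if for every $(x^{**},x^* )\in Z^{**}\times Z^*$ with $\inf_{(a,a^* )\in\operatorname{gra}B}\langle a-x^{**},a^*-x^*\rangle\ge0$ there is a bounded net in $\operatorname{gra}B$ converging weak$^*\times$strong to $(x^{**},x^* )$; - of type (BR) if whenever $(x,x^* )\in Z\times Z^*$, $\alpha,\beta>0$ and $\inf_{(a,a^* )\in\operatorname{gra}B}\langle x-a,x^*-a^*\rangle>-\alpha\beta$, there exists $(b,b^* )\in\operatorname{gra}B$ with $\|x-b\|<\alpha$ and $\|x^*-b^*\|<\beta$; - unique if all maximally monotone extensions of $B$ (graph inclusion) in $Z^{**}\times Z^*$ coincide. A Banach space is of type (D) if every maximally monotone operator on it is of type (D). *)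

(* Defs.v *)
From HB Require Import structures.
From mathcomp Require Import all_boot all_order all_algebra.
From mathcomp Require Import all_classical all_reals all_analysis.
From mathcomp Require Import ring lra.

Set Implicit Arguments.
Unset Strict Implicit.
Unset Printing Implicit Defensive.

Import Order.TTheory GRing.Theory Num.Theory.
Import numFieldNormedType.Exports.

Local Open Scope classical_set_scope.
Local Open Scope ring_scope.

Section Dual.
Context {R : realType} {E : normedModType R}.

Definition dual_pred : {pred E -> R^o} :=
  fun f => `[< linear f /\ continuous f >].

Record dual := Dual { dual_fun :> E -> R^o ; _ : dual_fun \in dual_pred }.

HB.instance Definition _ := [isSub for dual_fun].
HB.instance Definition _ := [Choice of dual by <:].

Lemma dual_pred_closed : submod_closed dual_pred.
Proof.
split=> [|a f g]; rewrite !unfold_in.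
  apply/asboolP; split=> [a x y|x]; last exact: cvg_cst.
  by rewrite -[LHS]/(0 : R^o) -[RHS]/(a *: (0 : R^o) + 0) scaler0 addr0.
move=> /asboolP[lf cf] /asboolP[lg cg]; apply/asboolP; split=> [b x y|x].
  rewrite -[LHS]/(a *: f (b *: x + y) + g (b *: x + y)).
  rewrite -[RHS]/(b *: (a *: f x + g x) + (a *: f y + g y)).
  by rewrite lf lg !scalerDr !scalerA mulrC addrACA.
by apply: cvgD; [apply: cvgZr; exact: cf|exact: cg].
Qed.
HB.instance Definition _ :=
  GRing.isSubmodClosed.Build _ _ dual_pred dual_pred_closed.
HB.instance Definition _ := [SubChoice_isSubLmodule of dual by <:].

Lemma dual_linear (f : dual) : linear f.
Proof. by case: f => f /=; rewrite unfold_in => /asboolP[]. Qed.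

HB.instance Definition _ (f : dual) :=
  GRing.isLinear.Build R E R^o _ (dual_fun f) (dual_linear f).

Lemma dual_continuous (f : dual) : continuous f.
Proof. by case: f => f /=; rewrite unfold_in => /asboolP[]. Qed.

Lemma dualP (f g : dual) : (forall x, f x = g x) -> f = g.
Proof. by move=> fg; apply/val_inj/funext. Qed.

Lemma dual_addE (f g : dual) x : (f + g) x = f x + g x.
Proof. by []. Qed.

Lemma dual_scaleE (a : R) (f : dual) x : (a *: f) x = a * f x.
Proof. by []. Qed.

Definition dual_norm (f : dual) : R :=
  sup [set `|f x| | x in [set x : E | `|x| <= 1]].

Lemma dual_norm_ubound (f : dual) :
  has_ubound [set `|f x| | x in [set x : E | `|x| <= 1]].
Proof.
have := @dual_continuous f.
move=> /linear_bounded_continuous /bounded_funP /(_ 1)[M fM].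
by exists M => _ [x x1 <-]; exact: fM.
Qed.

Lemma dual_norm_nonempty (f : dual) :
  [set `|f x| | x in [set x : E | `|x| <= 1]] !=set0.
Proof. by exists `|f 0|, 0 => //=; rewrite normr0. Qed.

Lemma dual_norm_le1 (f : dual) x : `|x| <= 1 -> `|f x| <= dual_norm f.
Proof.
by move=> x1; apply: (ub_le_sup (dual_norm_ubound f)); exists x.
Qed.

Lemma dual_norm_le (f : dual) x : `|f x| <= dual_norm f * `|x|.
Proof.
have [->|x0] := eqVneq x 0; first by rewrite raddf0 !normr0 mulr0.
have n0 : 0 < `|x| by rewrite normr_gt0.
have : `|f (`|x|^-1 *: x)| <= dual_norm f.
  by apply: dual_norm_le1; rewrite normfZV.
by rewrite linearZ /= normrM normfV normr_id ler_pdivrMl // mulrC.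
Qed.

Lemma dual_norm_ub (f : dual) (M : R) :
  (forall x, `|x| <= 1 -> `|f x| <= M) -> dual_norm f <= M.
Proof.
move=> fM; apply: (ge_sup (dual_norm_nonempty f)) => _ [x x1 <-].
exact: fM.
Qed.

Lemma dual_normD f g : dual_norm (f + g) <= dual_norm f + dual_norm g.
Proof.
apply: dual_norm_ub => x x1; rewrite dual_addE (le_trans (ler_normD _ _))//.
by rewrite lerD // dual_norm_le1.
Qed.

Lemma dual_normZ (a : R) f : dual_norm (a *: f) = `|a| * dual_norm f.
Proof.
have le b g : dual_norm (b *: g) <= `|b| * dual_norm g.
  apply: dual_norm_ub => x x1.
  by rewrite dual_scaleE normrM ler_wpM2l // dual_norm_le1.
apply/eqP; rewrite eq_le le /=.
have [->|a0] := eqVneq a 0.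
  rewrite normr0 mul0r.
  by apply: le_trans (dual_norm_le1 _ (x := 0) _); rewrite // normr0.
rewrite -ler_pdivlMl ?normr_gt0 // -normfV.
by have := le a^-1 (a *: f); rewrite scalerA mulVf // scale1r.
Qed.

Lemma dual_norm0 f : dual_norm f = 0 -> f = 0.
Proof.
move=> f0; apply: dualP => x; apply/normr0_eq0/le_anti.
by rewrite (le_trans (dual_norm_le f x)) ?f0 ?mul0r /=.
Qed.

HB.instance Definition _ := Lmodule_isNormed.Build R dual
  dual_normD dual_normZ dual_norm0.

End Dual.
Arguments dual {R} E.

Section WeakStar.
Context {R : realType} {E : normedModType R}.

Definition weakstar_cvg (T : Type) (u : T -> dual E) (F : set_system T)
    (l : dual E) : Prop :=
  forall x : E, u t x @[t --> F] --> l x.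

Let eval_at (x : E) : dual E -> R^o := fun f => f x.

Lemma eval_at_dual x : eval_at x \in @dual_pred R (dual E).
Proof.
rewrite unfold_in; apply/asboolP.
have ll : linear (eval_at x) by [].
split=> //.
pose L : {linear dual E -> R^o} :=
  HB.pack (eval_at x) (GRing.isLinear.Build _ _ _ _ _ ll).
apply/(@linear_bounded_continuous _ _ _ L)/bounded_funP => r.
exists (r * `|x|) => f fr; apply: le_trans (dual_norm_le f x) _.
by rewrite ler_wpM2r.
Qed.

Definition bidual_emb (x : E) : dual (dual E) := Dual (eval_at_dual x).

Lemma bidual_embE x f : bidual_emb x f = f x.
Proof. by []. Qed.

End WeakStar.

Section Bases.
Context {R : realType} {X : normedModType R}.
Implicit Types (e : nat -> X) (es : nat -> dual X).

(* Sequences indexed by {1, 2, ...} on paper are indexed by {0, 1, ...}. *)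
Definition schauder_basis e es : Prop :=
  (forall x,
    unique (fun a : nat -> R => series (fun n => a n *: e n) @ \oo --> x)
      (fun n => es n x))
  /\ (forall i j, es j (e i) = (i == j)%:R).

Definition lin_span (V : lmodType R) (v : nat -> V) : set V :=
  [set x | exists n (c : nat -> R), x = \sum_(i < n) c i *: v i].

Definition shrinking es : Prop := closure (lin_span es) = setT.

(* When the partial sums of e converge weak* in the bidual, as they do
   wherever this is used, the series over i > n converges for every ys and limn
   is its sum (limn of a divergent sequence would be arbitrary). *)
Definition skew_coef e (ys : dual X) (n : nat) : R :=
  limn (fun m => \sum_(n.+1 <= i < m) ys (e i)) - \sum_(i < n) ys (e i).

Definition skew_op e (ys : dual X) : set (dual (dual X)) :=
  [set yss | weakstar_cvg
     (fun k => bidual_emb (\sum_(n < k) skew_coef e ys n *: e n)) \oo yss].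

End Bases.

Section MonotoneSets.
Context {R : realType} {U V : zmodType} (pairing : U -> V -> R).

Definition monotone_set (G : set (U * V)) : Prop :=
  forall p q, G p -> G q -> 0 <= pairing (p.1 - q.1) (p.2 - q.2).

Definition maximal_monotone_set (G : set (U * V)) : Prop :=
  monotone_set G /\ forall H, monotone_set H -> G `<=` H -> H = G.

End MonotoneSets.

Section Operators.
Context {R : realType} {Z : normedModType R}.
Implicit Type B : Z -> set (dual Z).

Definition gra B : set (Z * dual Z) := [set p | B p.1 p.2].

Definition maximally_monotone B : Prop :=
  maximal_monotone_set (fun (x : Z) (xs : dual Z) => xs x) (gra B).

Definition linear_relation B : Prop :=
  gra B 0 /\ forall (c : R) p q, gra B p -> gra B q -> gra B (c *: p + q).

Definition skew_relation B : Prop := forall x xs, gra B (x, xs) -> xs x = 0.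

Definition add_op B C : Z -> set (dual Z) :=
  fun x => [set u + v | u in B x & v in C x].

Definition rank_one_op (f : dual Z) : Z -> set (dual Z) :=
  fun x => [set f x *: f].

Definition directed (I : Type) (le : I -> I -> Prop) : Prop :=
  [/\ inhabited I, forall i, le i i,
      forall i j k, le i j -> le j k -> le i k
    & forall i j, exists k, le i k /\ le j k].

Definition tails (I : Type) (le : I -> I -> Prop) : set_system I :=
  [set P | exists i, forall j, le i j -> P j].

Definition typeD B : Prop :=
  forall (xss : dual (dual Z)) (xs : dual Z),
    (0 <= ereal_inf
      [set ((bidual_emb p.1 - xss) (p.2 - xs))%:E | p in gra B])%E ->
    exists (I : Type) (le : I -> I -> Prop) (a : I -> Z) (as_ : I -> dual Z),
      [/\ directed le,
          forall i, gra B (a i, as_ i),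
          exists M : R, forall i, `|a i| <= M /\ `|as_ i| <= M,
          weakstar_cvg (fun i => bidual_emb (a i)) (tails le) xss
        & as_ @ tails le --> xs].

Definition typeBR B : Prop :=
  forall (x : Z) (xs : dual Z) (alpha beta : R), 0 < alpha -> 0 < beta ->
    ((- (alpha * beta))%:E
      < ereal_inf [set ((xs - p.2) (x - p.1))%:E | p in gra B])%E ->
    exists b bs, [/\ gra B (b, bs), `|x - b| < alpha & `|xs - bs| < beta].

Definition unique_op B : Prop :=
  forall C1 C2 : set (dual (dual Z) * dual Z),
    let ext C :=
      maximal_monotone_set (fun (zss : dual (dual Z)) (zs : dual Z) => zss zs) C
      /\ (forall x xs, gra B (x, xs) -> C (bidual_emb x, xs)) in
    ext C1 -> ext C2 -> C1 = C2.

End Operators.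

Definition typeD_space (R : realType) (Y : normedModType R) : Prop :=
  forall B : Y -> set (dual Y), maximally_monotone B -> typeD B.

(* T is an isomorphism of Z onto its image in Y. *)
Definition contains_copy (R : realType) (Z Y : normedModType R) : Prop :=
  exists (T : {linear Z -> Y}) (c C : R), 0 < c /\
    forall z, c * `|z| <= `|T z| /\ `|T z| <= C * `|z|.

Section James.
Context {R : realType}.
Implicit Types (x y : nat -> R^o) (s : seq nat).

(* The sum of squares of a (possibly empty) selection n_1 < ... < n_k, given as
   the list s; it is 0 when k <= 1. *)
Definition qvar x s : R :=
  \sum_(i < (size s).-1) (x (nth 0%N s i) - x (nth 0%N s i.+1)) ^+ 2.

Definition james_set x : set R :=
  [set Num.sqrt (qvar x s) | s in [set s | sorted ltn s]].

Definition james_pred : {pred nat -> R^o} :=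
  fun x => `[< x @ \oo --> (0 : R) /\ has_ubound (james_set x) >].

Record james :=
  James { james_seq :> nat -> R^o ; _ : james_seq \in james_pred }.

HB.instance Definition _ := [isSub for james_seq].
HB.instance Definition _ := [Choice of james by <:].

Lemma minkowski_sum (n : nat) (a b : 'I_n -> R) :
  Num.sqrt (\sum_i (a i + b i) ^+ 2)
    <= Num.sqrt (\sum_i a i ^+ 2) + Num.sqrt (\sum_i b i ^+ 2).
Proof.
set A := \sum_i a i ^+ 2; set B := \sum_i b i ^+ 2.
have A0 : 0 <= A by apply: sumr_ge0 => i _; exact: sqr_ge0.
have B0 : 0 <= B by apply: sumr_ge0 => i _; exact: sqr_ge0.
pose C := \sum_i a i * b i.
have eB : \sum_i (B * a i - C * b i) ^+ 2 = B * (A * B - C ^+ 2).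
  have t i : (B * a i - C * b i) ^+ 2 =
      B ^+ 2 * a i ^+ 2 - (2 * B * C) * (a i * b i) + C ^+ 2 * b i ^+ 2 by ring.
  under eq_bigr do rewrite t.
  rewrite big_split sumrB -!mulr_sumr -/A -/B -/C /=; ring.
have CAB : C ^+ 2 <= A * B.
  have [B00|Bn0] := eqVneq B 0.
    suff -> : C = 0 by rewrite expr0n mulr_ge0.
    rewrite /C big1 // => i _; apply/eqP; rewrite mulf_eq0; apply/orP; right.
    rewrite -sqrf_eq0; have /psumr_eq0P := B00.
    by move=> -> // j _; exact: sqr_ge0.
  have Bp : 0 < B by rewrite lt_def Bn0.
  rewrite -subr_ge0 -(pmulr_rge0 _ Bp) -eB.
  by apply: sumr_ge0 => i _; exact: sqr_ge0.
rewrite -(@ler_pXn2r _ 2) ?nnegrE ?addr_ge0 ?sqrtr_ge0 //.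
rewrite sqrrD !sqr_sqrtr //; last by apply: sumr_ge0 => i _; exact: sqr_ge0.
rewrite -sqrtrM //.
have -> : \sum_i (a i + b i) ^+ 2 = A + C *+ 2 + B.
  rewrite /A /B /C -sumrMnl -!big_split /=.
  by apply: eq_bigr => i _; ring.
rewrite lerD2r lerD2l lerMn2r /=.
apply: le_trans (ler_norm _) _.
by rewrite -sqrtr_sqr ler_wsqrtr.
Qed.

Lemma qvarD x y s :
  Num.sqrt (qvar (x + y) s) <= Num.sqrt (qvar x s) + Num.sqrt (qvar y s).
Proof.
apply: le_trans (minkowski_sum _ _); rewrite ler_wsqrtr // le_eqVlt.
apply/orP; left; apply/eqP/eq_bigr => i _; congr (_ ^+ 2).
by rewrite opprD addrACA.
Qed.

Lemma qvarZ (a : R) x s :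
  Num.sqrt (qvar (a *: x) s) = `|a| * Num.sqrt (qvar x s).
Proof.
rewrite -sqrtr_sqr -sqrtrM ?sqr_ge0 // /qvar mulr_sumr.
congr (Num.sqrt _); apply: eq_bigr => i _.
by rewrite -exprMn mulrBr.
Qed.

Lemma james_pred_closed : submod_closed james_pred.
Proof.
split=> [|a x y]; rewrite !unfold_in.
  apply/asboolP; split; first exact: cvg_cst.
  exists 0 => _ [s _ <-]; rewrite /qvar big1 ?sqrtr0 // => i _.
  by rewrite subrr expr0n.
move=> /asboolP[x0 [Mx xM]] /asboolP[y0 [My yM]]; apply/asboolP; split.
  rewrite -[0 : R]addr0 -{1}[0 : R](mulr0 a).
  by apply: cvgD => //; exact: cvgZr.
exists (`|a| * Mx + My) => _ [s ss <-].
apply: le_trans (qvarD _ _ _) _; rewrite qvarZ lerD //.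
  by rewrite ler_wpM2l //; apply: xM; exists s.
by apply: yM; exists s.
Qed.
HB.instance Definition _ :=
  GRing.isSubmodClosed.Build _ _ james_pred james_pred_closed.
HB.instance Definition _ := [SubChoice_isSubLmodule of james by <:].

Definition james_norm (x : james) : R := sup (james_set x).

Lemma james_cvg0 (x : james) : (x : nat -> R^o) @ \oo --> (0 : R).
Proof. by case: x => x /=; rewrite unfold_in => /asboolP[]. Qed.

Lemma james_ubound (x : james) : has_ubound (james_set x).
Proof. by case: x => x /=; rewrite unfold_in => /asboolP[]. Qed.

Lemma qvar_le_norm (x : james) s :
  sorted ltn s -> Num.sqrt (qvar x s) <= james_norm x.
Proof. by move=> ss; apply: (ub_le_sup (james_ubound x)); exists s. Qed.

Lemma james_norm_ub (x : james) (M : R) :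
  (forall s, sorted ltn s -> Num.sqrt (qvar x s) <= M) -> james_norm x <= M.
Proof.
move=> xM; apply: ge_sup => [|_ [s ss <-]]; last exact: xM.
by exists (Num.sqrt (qvar x [::])), [::].
Qed.

Lemma james_normD (x y : james) :
  james_norm (x + y) <= james_norm x + james_norm y.
Proof.
apply: james_norm_ub => s ss; apply: le_trans (qvarD _ _ _) _.
by rewrite lerD // qvar_le_norm.
Qed.

Lemma james_norm_ge0 (x : james) : 0 <= james_norm x.
Proof. by apply: le_trans (@qvar_le_norm x [::] isT); exact: sqrtr_ge0. Qed.

Lemma james_normZ (a : R) (x : james) :
  james_norm (a *: x) = `|a| * james_norm x.
Proof.
have le b (z : james) : james_norm (b *: z) <= `|b| * james_norm z.
  by apply: james_norm_ub => s ss; rewrite qvarZ ler_wpM2l // qvar_le_norm.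
apply/eqP; rewrite eq_le le /=.
have [->|a0] := eqVneq a 0; first by rewrite normr0 mul0r james_norm_ge0.
rewrite -ler_pdivlMl ?normr_gt0 // -normfV.
by have := le a^-1 (a *: x); rewrite scalerA mulVf // scale1r.
Qed.

Lemma coord_le_norm (x : james) (n : nat) : `|x n| <= james_norm x.
Proof.
have sub (m : nat) : (n < m)%N -> `|x n - x m| <= james_norm x.
  move=> nm; have := @qvar_le_norm x [:: n; m].
  by rewrite /= nm andbT /qvar /= big_ord1 /= sqrtr_sqr => ->.
have c : `|x n - x m| @[m --> \oo] --> `|x n - 0|.
  by apply: cvg_norm; apply: cvgB; [exact: cvg_cst|exact: james_cvg0].
rewrite subr0 in c.
apply: (closed_cvg (fun v : R => v <= james_norm x) _ _ _ c).
  exact: closed_le.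
by near=> m; apply: sub; near: m; exact: nbhs_infty_gt.
Unshelve. all: by end_near. Qed.

Lemma james_norm0 (x : james) : james_norm x = 0 -> x = 0.
Proof.
move=> x0; apply/val_inj/funext => n; apply/normr0_eq0/le_anti.
by rewrite normr_ge0 andbT -x0 coord_le_norm.
Qed.

HB.instance Definition _ := Lmodule_isNormed.Build R james
  james_normD james_normZ james_norm0.


Lemma james_cauchy_limit (F : set_system james) (l : nat -> R^o) (A : set james)
    (e : R) : ProperFilter F -> F A ->
  (forall x y : james, A x -> A y -> `|x - y| <= e) ->
  (forall n, (x n : R) @[x --> F] --> (l n : R)) ->
  forall x : james, A x -> (forall s, sorted ltn s -> Num.sqrt (qvar (l - x) s) <= e)
    /\ (forall n, `|l n - x n| <= e).
Proof.
move=> FF FA Ae Fl x Ax; split=> [s ss|n].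
  have c : Num.sqrt (qvar (y - x : james) s) @[y --> F]
      --> Num.sqrt (qvar (l - x) s).
    apply: cvg_comp; last exact: sqrt_continuous.
    apply: cvg_big => [|i _]; first exact: add_continuous.
    rewrite expr2; under eq_fun do rewrite expr2.
    have d k : ((y : james) k - x k : R) @[y --> F] --> (l k - x k : R).
      by apply: cvgB; [exact: Fl|exact: cvg_cst].
    by apply: cvgM; apply: cvgB; exact: d.
  apply: (closed_cvg (fun v : R => v <= e) _ _ _ c); first exact: closed_le.
  apply: filterS FA => y Ay; apply: le_trans (Ae y x Ay Ax).
  exact: qvar_le_norm.
have c : `|(y : james) n - x n| @[y --> F] --> `|l n - x n|.
  by apply: cvg_norm; apply: cvgB; [exact: Fl|exact: cvg_cst].
apply: (closed_cvg (fun v : R => v <= e) _ _ _ c); first exact: closed_le.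
apply: filterS FA => y Ay; apply: le_trans (Ae y x Ay Ax).
exact: (coord_le_norm (y - x)).
Qed.

Lemma james_complete (F : set_system james) :
  ProperFilter F -> cauchy F -> cvg F.
Proof.
move=> FF /cauchy_ballP Fc.
have small e : 0 < e -> exists2 A, F A & forall x y : james, A x -> A y -> `|x - y| <= e.
  move=> e0; have [[P Q] /= [FP FQ] PQ] := Fc _ e0.
  exists (P `&` Q) => [|x y [Px _] [_ Qy]]; first exact: filterI.
  have /= := PQ (x, y) (conj Px Qy).
  by rewrite -ball_normE => /ltW.
have Fl n : cvg ((x n : R) @[x --> F]).
  apply/cauchy_cvgP/cauchy_ballP => e e0; near_simpl.
  have [A FA Ae] := small _ (divr_gt0 e0 (ltr0n _ 2)).
  exists (A, A) => //= -[x y] /= [Ax Ay].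
  rewrite -ball_normE /ball_ /=; apply: le_lt_trans (coord_le_norm (x - y) n) _.
  by apply: le_lt_trans (Ae _ _ Ax Ay) _; rewrite ltr_pdivrMr // mulr_natr mulr2n ltrDl.
pose l n : R^o := lim ((x n : R) @[x --> F]).
have lP e : 0 < e -> exists2 A, F A & forall x : james, A x ->
    (forall s, sorted ltn s -> Num.sqrt (qvar (l - x) s) <= e)
    /\ (forall n, `|l n - x n| <= e).
  move=> e0; have [A FA Ae] := small _ e0; exists A => //.
  exact: (@james_cauchy_limit F l A e FF FA Ae Fl).
have lJ : l \in james_pred.
  rewrite unfold_in; apply/asboolP; split.
    apply/cvgr0Pnorm_lt => e e0.
    have e20 : 0 < e / 2 by rewrite divr_gt0.
    have [A FA Ae] := lP _ e20; have [x Ax] := filter_ex FA.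
    have /cvgr0Pnorm_lt /(_ _ e20) := james_cvg0 x.
    apply: filterS => n xn; rewrite -[l n](subrK (x n)).
    apply: le_lt_trans (ler_normD _ _) _; rewrite [ltRHS](splitr e).
    by apply: ler_ltD => //; have [_ ->] := Ae _ Ax.
  have [A FA Ae] := lP _ ltr01; have [x Ax] := filter_ex FA.
  exists (1 + `|x|) => _ [s ss <-].
  rewrite -[l](subrK (x : nat -> R^o)).
  apply: le_trans (qvarD _ _ _) _; apply: lerD; last exact: qvar_le_norm.
  by have [->] := Ae _ Ax.
apply/cvg_ex; exists (James lJ); apply/cvgrPdist_le => e e0.
have [A FA Ae] := lP _ e0; apply: filterS FA => x Ax.
by apply: james_norm_ub => s ss; have [->] := Ae _ Ax.
Qed.

HB.instance Definition _ := Uniform_isComplete.Build james james_complete.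

Definition unit_seq (n : nat) : nat -> R^o := fun k => (k == n)%:R.

Lemma unit_seq_james n : unit_seq n \in james_pred.
Proof.
rewrite unfold_in; apply/asboolP; split.
  apply: cvg_near_cst; near=> k.
  by rewrite /unit_seq gtn_eqF //; near: k; exact: nbhs_infty_gt.
exists (Num.sqrt 2) => _ [s ss <-]; rewrite ler_wsqrtr //.
have us : uniq s by apply: sorted_uniq ss; [exact: ltn_trans|exact: ltnn].
pose d (k : nat) : R := (nth 0%N s k == n)%:R.
have ds : \sum_(0 <= k < size s) d k <= 1.
  rewrite -(big_nth 0%N predT (fun j => (j == n)%:R)).
  have -> : \sum_(j <- s) ((j == n)%:R : R) = (count_mem n s)%:R.
    by elim: (s) => [|j t IH]; rewrite ?big_nil // big_cons IH /= natrD.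
  by rewrite count_uniq_mem // lern1 leq_b1.
have [s0|s0] := posnP (size s); first by rewrite /qvar s0 big_ord0.
rewrite /qvar; move: ds; rewrite -{1}(prednK s0) big_mkord /=; set m := (size s).-1 => ds.
apply: (@le_trans _ _ (\sum_(i < m) (d i + d i.+1))).
  apply: ler_sum => i _; rewrite /unit_seq /d.
  by case: eqP; case: eqP => _ _ /=; nra.
rewrite big_split /=; have -> : 2 = 1 + 1 :> R by ring.
by apply: lerD; apply: le_trans ds;
  [rewrite big_ord_recr /= lerDl|rewrite big_ord_recl /= lerDr]; exact: ler0n.
Unshelve. all: by end_near. Qed.

Definition james_unit (n : nat) : james := James (unit_seq_james n).

Let coord (n : nat) : james -> R^o := fun x : james => x n.

Lemma coord_dual n : coord n \in @dual_pred R james.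
Proof.
rewrite unfold_in; apply/asboolP.
have ll : linear (coord n) by [].
split=> //.
pose L : {linear james -> R^o} :=
  HB.pack (coord n) (GRing.isLinear.Build _ _ _ _ _ ll).
apply/(@linear_bounded_continuous _ _ _ L)/bounded_funP => r.
by exists r => x xr; exact: le_trans (coord_le_norm x n) xr.
Qed.

Definition james_coord (n : nat) : dual james := Dual (coord_dual n).

End James.
Arguments james R : clear implicits.

(* Main.v *)
Require Import Defs.
From HB Require Import structures.
From mathcomp Require Import all_boot all_order all_algebra.
From mathcomp Require Import all_classical all_reals all_analysis.
From mathcomp Require Import ring lra.

Set Implicit Arguments.
Unset Strict Implicit.
Unset Printing Implicit Defensive.

Import Order.TTheory GRing.Theory Num.Theory.
Import numFieldNormedType.Exports.

Local Open Scope classical_set_scope.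
Local Open Scope ring_scope.

(** Write s_n for the sum of the first n basis vectors and T for the sum of A
    and the rank-one operator of ebar.

    Since <y, s_n> tends to <ebar, y>, the n-th coefficient in the definition
    of A is <ebar, y> - <y, s_n> - <y, s_(n+1)>.  As the basis is shrinking, an
    element of the bidual is the weak-star limit of the partial sums built from
    its coordinates, so A consists of the pairs (y, y'') in which y'' has these
    coordinates (skew_opP).  Multiplying the coefficient by <y, e_n> and summing
    telescopes to <ebar, y> <y, s_k> - <y, s_k>^2, which tends to 0: A is skew.
    Its graph contains the pairs (es_j, s_j + s_(j+1) - ebar).  If the duality
    pairing of a point against the graph of A is merely bounded below, then its
    linear part vanishes on the graph, because the graph is a subspace on which
    the quadratic part is zero; tested on the pairs above, this says that the
    point has the right coordinates and already lies in the graph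
    (skew_op_bounded).  Maximality is the case of the bound 0, and in the
    definition of type (BR) the given point itself can be taken.

    The operator T satisfies <Ty, y> = <ebar, y>^2, and the coordinates of Ty
    are 2 <ebar, y> - <y, s_n> - <y, s_(n+1)>, hence tend to 0, whereas all
    coordinates of ebar are 1.  When the coordinate functionals are bounded,
    a weak-star cluster point phi of them is a functional on the bidual that
    vanishes on the range of T and equals 1 at ebar.  This is the obstruction
    used below.  The pairing of (k phi, 2 m ebar) against a point of the graph
    of T is (<ebar, y> - m)^2 + m (2 k - m), so this point is monotonically
    related to the graph as soon as 0 <= m <= 2 k.  For m > 0 it is no limit of
    the graph, since phi separates 2 m ebar from the closure of the range; so T
    is not of type (D).  The points with (k, m) = (2, 1) and (1, 2) are not monotonically
    related to each other, so they belong to different maximal monotone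
    extensions, and T is not unique.

    If L embeds Z isomorphically in Y with adjoint L', the relation
    (L')^-1 T L^-1 is again maximally monotone: by the Hahn-Banach theorem L' is
    onto, and the first component of a point related to the graph is annihilated
    by all functionals that vanish on the closed range of L, hence lies in it.
    The obstruction is carried along, so Y is not of type (D).

    Finally, in the James space the unit vectors form a basis because a tail of
    x can be appended to a selection that nearly attains the norm of x.
    The basis is shrinking because normalized consecutive blocks satisfy an
    upper 2-estimate: a functional that is large on N such blocks has norm of
    order sqrt N at least. *)

(** * Maximal extensions *)

Lemma chain_bigcup2 (T : Type) (F : set (set T)) p q :
  total_on F subset -> (\bigcup_(A in F) A) p -> (\bigcup_(A in F) A) q ->
  exists2 A, F A & A p /\ A q.
Proof.
move=> Ftot [A FA Ap] [B FB Bq].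
by have [AB|BA] := Ftot A B FA FB; [exists B|exists A] => //; split => //;
  [exact: AB|exact: BA].
Qed.

(** The chains of Zorn's lemma include the empty one, whose union need not
    satisfy P; maximizing A subject to P (A `|` G) removes this case. *)
Lemma zorn_extension (T : Type) (P : set (set T)) (G : set T) :
  (forall F : set (set T), F !=set0 -> F `<=` P -> total_on F subset ->
    P (\bigcup_(A in F) A)) ->
  P G ->
  exists A, [/\ G `<=` A, P A & forall B, P B -> A `<=` B -> B = A].
Proof.
move=> Pchain PG.
have [F FP Ftot|A [PA Amax]] := @Zorn_bigcup T [set A | P (A `|` G)].
  have [->|/set0P[A0 FA0]] := eqVneq F set0.
    by rewrite /= bigcup_set0 set0U.
  rewrite /=; have -> : (\bigcup_(A in F) A) `|` G =
      \bigcup_(A in [set A `|` G | A in F]) A.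
    apply/seteqP; split=> p.
      move=> [[A FA Ap]|Gp]; first by exists (A `|` G); [exists A|left].
      by exists (A0 `|` G); [exists A0|right].
    move=> [_ [A FA <-] [Ap|Gp]]; last by right.
    by left; exists A.
  apply: Pchain; first by exists (A0 `|` G), A0.
    by move=> _ [A FA <-]; exact: FP.
  move=> _ _ [A FA <-] [B FB <-].
  by have [AB|BA] := Ftot A B FA FB; [left|right]; exact: setSU.
exists (A `|` G); split=> // B PB AGB; apply/seteqP; split=> //.
have GB : G `<=` B by move=> p Gp; apply: AGB; right.
apply: contrapT => nBA; apply: (Amax B); last by rewrite /= setUidl.
split; first by move=> p Ap; apply: AGB; left.
by move=> BA; apply: nBA => p /BA; left.
Qed.

Lemma monotone_maximal_extension (R : realType) (U V : zmodType)
    (pairing : U -> V -> R) (G : set (U * V)) :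
  monotone_set pairing G ->
  exists2 C, maximal_monotone_set pairing C & G `<=` C.
Proof.
move=> mG; have [F F0 FP Ftot p q Fp Fq|C [GC mC Cmax]] :=
    @zorn_extension _ (monotone_set pairing) G _ mG.
  by have [A FA [Ap Aq]] := chain_bigcup2 Ftot Fp Fq; exact: FP FA _ _ Ap Aq.
by exists C => //; split=> // H mH CH; exact: Cmax.
Qed.

(** * The Hahn-Banach theorem *)

Section HahnBanach.
Context {R : realType} {V : lmodType R}.
Variable p : V -> R.
Hypothesis pD : forall x y, p (x + y) <= p x + p y.
Hypothesis pZ : forall (a : R) x, 0 <= a -> p (a *: x) = a * p x.

(** Partial functionals are handled as graphs.  A dominated graph that is
    a subspace is automatically single-valued, since p 0 = 0. *)
Definition dominated_graph (G : set (V * R^o)) : Prop :=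
  [/\ G 0, forall (c : R) u v, G u -> G v -> G (c *: u + v)
    & forall v, G v -> v.2 <= p v.1].

(** The value a at x has to satisfy r - p (u - x) <= a <= p (v + x) - r' for
    all (u, r) and (v, r') in G; subadditivity of p makes these constraints
    compatible, and homogeneity reduces the multiples of x to these two. *)
Lemma dominated_graph_extend G x : dominated_graph G ->
  exists2 H, dominated_graph H & G `<=` H /\ exists a, H (x, a).
Proof.
move=> [G0 Glin Gp].
have GD u v : G u -> G v -> G (u + v).
  by move=> Gu Gv; rewrite -[u]scale1r; exact: Glin.
have GZ c u : G u -> G (c *: u).
  by move=> Gu; rewrite -[_ *: _]addr0; exact: Glin.
pose S := [set u.2 - p (u.1 - x) | u in G].
have Sub u v : G u -> G v -> u.2 - p (u.1 - x) <= p (v.1 + x) - v.2.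
  move=> Gu Gv; rewrite lerBlDr addrAC -lerBlDr opprK.
  have /= := Gp _ (GD _ _ Gu Gv) => /le_trans; apply.
  by apply: le_trans (pD _ _); rewrite addrACA subrr addr0 addrC.
have S0 : S !=set0 by exists (0 - p (0 - x)), 0.
have Sb : has_ubound S.
  by exists (p (0 + x) - 0) => _ [u Gu <-]; exact: Sub _ _ Gu G0.
pose a := sup S.
have aL u : G u -> u.2 - p (u.1 - x) <= a.
  by move=> Gu; apply: (ub_le_sup Sb); exists u.
have aR v : G v -> a <= p (v.1 + x) - v.2.
  by move=> Gv; apply: (ge_sup S0) => _ [u Gu <-]; exact: Sub.
exists [set w | exists u t, G u /\ w = (u.1 + t *: x, u.2 + t * a)]; last first.
  split=> [u Gu|]; first by exists u, 0; split=> //;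
    rewrite scale0r mul0r !addr0 -surjective_pairing.
  by exists a, 0, 1; split=> //=; rewrite scale1r mul1r !add0r.
split.
- by exists 0, 0; split=> //=; rewrite scale0r mul0r !addr0.
- move=> c _ _ [u [t [Gu ->]]] [v [s [Gv ->]]].
  exists (c *: u + v), (c * t + s); split; first exact: Glin.
  congr pair => /=.
    by rewrite scalerDr scalerA addrACA -scalerDl.
  by rewrite /GRing.scale /=; ring.
- move=> _ [u [t [Gu ->]]] /=.
  have [t0|t0|->] := ltgtP t 0; last by rewrite scale0r mul0r !addr0; exact: Gp.
    have t'0 : 0 < - t by rewrite oppr_gt0.
    have t'n : - t != 0 by rewrite gt_eqF.
    have -> : u.1 + t *: x = (- t) *: ((- t)^-1 *: u.1 - x).
      by rewrite scalerBr scalerA mulfV // scale1r scaleNr opprK.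
    rewrite (pZ _ (ltW t'0)).
    have := aL _ (GZ (- t)^-1 _ Gu); rewrite lerBlDr /=.
    rewrite -[_ *: u.2]/(_ * u.2) ler_pdivrMl //.
    by lra.
  have tn : t != 0 by rewrite gt_eqF.
  have -> : u.1 + t *: x = t *: (t^-1 *: u.1 + x).
    by rewrite scalerDr scalerA mulfV // scale1r.
  rewrite (pZ _ (ltW t0)).
  have := aR _ (GZ t^-1 _ Gu); rewrite lerBrDr /=.
  rewrite -[_ *: u.2]/(_ * u.2) -[_ <= p _](ler_pM2l t0) mulrDr mulVKf //; lra.
Qed.

Theorem hahn_banach G : dominated_graph G ->
  exists2 f : {linear V -> R^o}, forall v, f v <= p v
    & forall v, G v -> f v.1 = v.2.
Proof.
move=> dG.
have [F [A0 FA0] FP Ftot|H [GH dH Hmax]] := zorn_extension _ dG.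
  split.
  - by exists A0 => //; have [] := FP _ FA0.
  - move=> c u v Fu Fv; have [A FA [Au Av]] := chain_bigcup2 Ftot Fu Fv.
    by exists A => //; have [_ lin _] := FP _ FA; exact: lin.
  - by move=> v [A FA Av]; have [_ _] := FP _ FA; exact.
have Htot x : exists a, H (x, a).
  have [K dK [HK [a Ka]]] := dominated_graph_extend x dH.
  by exists a; rewrite -(Hmax _ dK HK).
have [H0 Hlin Hp] := dH.
have p0 : p 0 = 0 by rewrite -(scale0r 0) pZ // mul0r.
have Hfun x a b : H (x, a) -> H (x, b) -> a = b.
  have le c d : H (x, c) -> H (x, d) -> c <= d.
    move=> Hc Hd; have := Hp _ (Hlin (-1) _ _ Hd Hc).
    by rewrite /= (scaleN1r x) addNr p0 -[_ *: d]/(-1 * d); lra.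
  by move=> Ha Hb; apply/le_anti; rewrite !le.
have [f Hf] := choice Htot.
have lf : linear (f : V -> R^o).
  move=> c x y; apply: Hfun (Hf _) _.
  by have := Hlin c _ _ (Hf x) (Hf y).
pose L : {linear V -> R^o} := HB.pack f (GRing.isLinear.Build _ _ _ _ _ lf).
exists L => /=.
- by move=> v; exact: Hp _ (Hf v).
- by move=> [v a] Gv; exact: Hfun (Hf v) (GH _ Gv).
Qed.

End HahnBanach.

(** * Dual spaces *)

Section DualTools.
Context {R : realType} {E : normedModType R}.
Implicit Types f g : dual E.

Lemma dual_oppE f x : (- f) x = - f x. Proof. by []. Qed.

Lemma dual_subE f g x : (f - g) x = f x - g x. Proof. by []. Qed.

Lemma dual_zeroE x : (0 : dual E) x = 0. Proof. by []. Qed.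

Lemma dual_fun0 f : f 0 = 0. Proof. exact: linear0. Qed.

Lemma dual_funD f x y : f (x + y) = f x + f y. Proof. exact: linearD. Qed.

Lemma dual_funB f x y : f (x - y) = f x - f y. Proof. exact: linearB. Qed.

Lemma dual_funN f x : f (- x) = - f x. Proof. exact: linearN. Qed.

Lemma dual_funZ f a x : f (a *: x) = a * f x. Proof. exact: linearZ. Qed.

Lemma dual_fun_sum f (I : Type) (r : seq I) (P : pred I) (F : I -> E) :
  f (\sum_(i <- r | P i) F i) = \sum_(i <- r | P i) f (F i).
Proof. exact: linear_sum. Qed.

(** Monotonicity along a line is a quadratic inequality in t. *)
Lemma pairing_line f g x y (t : R) :
  (f - t *: g) (x - t *: y) = f x - t * (f y + g x) + t ^+ 2 * g y.
Proof. rewrite dual_subE dual_scaleE !dual_funB !dual_funZ; ring. Qed.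

Lemma dual_sumE (I : Type) (r : seq I) (P : pred I) (F : I -> dual E) x :
  (\sum_(i <- r | P i) F i) x = \sum_(i <- r | P i) F i x.
Proof. exact: (big_morph (fun f : dual E => f x)). Qed.

Lemma bounded_linear_dual (f : E -> R^o) (M : R) :
  linear f -> (forall x, `|f x| <= M * `|x|) ->
  exists g : dual E, forall x, g x = f x.
Proof.
move=> lf fM; suff fd : f \in @dual_pred R E by exists (Dual fd).
rewrite unfold_in; apply/asboolP; split=> //.
pose L : {linear E -> R^o} := HB.pack f (GRing.isLinear.Build _ _ _ _ _ lf).
apply/(@linear_bounded_continuous _ _ _ L)/bounded_funP => r.
exists (`|M| * r) => x xr; apply: le_trans (fM x) _.
apply: le_trans (ler_wpM2l (normr_ge0 M) xr).
by rewrite ler_wpM2r // ler_norm.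
Qed.

Lemma dual_norm_le_bound f (M : R) : 0 <= M ->
  (forall x, `|f x| <= M * `|x|) -> `|f| <= M.
Proof.
move=> M0 fM; apply: dual_norm_ub => x x1; apply: le_trans (fM x) _.
by rewrite ler_piMr.
Qed.

Lemma dual_apply_le f x : `|f x| <= `|f| * `|x|.
Proof. exact: dual_norm_le. Qed.

Lemma dual_complete (F : set_system (dual E)) :
  ProperFilter F -> cauchy F -> cvg F.
Proof.
move=> FF /cauchy_ballP Fc.
have small e : 0 < e ->
    exists2 A, F A &
      forall f g, A f -> A g -> forall x, `|f x - g x| <= e * `|x|.
  move=> e0; have [[P Q] /= [FP FQ] PQ] := Fc _ e0.
  exists (P `&` Q) => [|f g [Pf _] [_ Qg] x]; first exact: filterI.
  have /= := PQ (f, g) (conj Pf Qg); rewrite -ball_normE => /ltW fg.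
  apply: le_trans (dual_apply_le (f - g) x) _.
  by rewrite ler_wpM2r.
have Fl x : cvg (((f : dual E) x : R) @[f --> F]).
  apply/cauchy_cvgP/cauchy_ballP => e e0; near_simpl.
  have n0 : 0 < `|x| + 1 by rewrite ltr_wpDl.
  have [A FA Ae] := small _ (divr_gt0 e0 n0).
  exists (A, A) => //= -[f g] /= [Af Ag].
  rewrite -ball_normE /ball_ /=; apply: le_lt_trans (Ae _ _ Af Ag x) _.
  by rewrite mulrAC ltr_pdivrMr // ltr_pM2l // ltrDl.
pose l x : R^o := lim (((f : dual E) x : R) @[f --> F]).
have ll : linear l.
  move=> a x y; apply/cvg_lim => //.
  have -> : (fun f : dual E => f (a *: x + y) : R) =
      (fun f : dual E => a * f x + f y).
    by apply/funext => f; rewrite linearP.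
  by apply: cvgD; [apply: cvgMr; exact: Fl|exact: Fl].
have lP e : 0 < e -> exists2 A, F A & forall f, A f ->
    forall x, `|l x - f x| <= e * `|x|.
  move=> e0; have [A FA Ae] := small _ e0; exists A => // f Af x.
  have c : `|(g : dual E) x - f x| @[g --> F] --> `|l x - f x|.
    by apply: cvg_norm; apply: cvgB; [exact: Fl|exact: cvg_cst].
  apply: (closed_cvg (fun v : R => v <= e * `|x|) _ _ _ c).
    exact: closed_le.
  by apply: filterS FA => g Ag; exact: Ae.
have [A FA Al] := lP _ ltr01; have [f0 Af0] := filter_ex FA.
have [x|g gl] := @bounded_linear_dual l (1 + `|f0|) ll.
  rewrite -[l x](subrK (f0 x)) (le_trans (ler_normD _ _)) // mulrDl.
  by apply: lerD; [exact: Al|exact: dual_apply_le].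
apply/cvg_ex; exists g; apply/cvgrPdist_le => e e0.
have [B FB Be] := lP _ e0; apply: filterS FB => f Bf.
apply: dual_norm_le_bound (ltW e0) _ => x.
by rewrite dual_subE gl; exact: Be.
Qed.

HB.instance Definition _ := Uniform_isComplete.Build (dual E) dual_complete.

End DualTools.

Section Embedding.
Context {R : realType} {Z : completeNormedModType R} {Y : normedModType R}.
Variables (T : {linear Z -> Y}) (c C : R).
Hypotheses (c0 : 0 < c) (cT : forall z, c * `|z| <= `|T z|)
  (TC : forall z, `|T z| <= C * `|z|).

Lemma dual_restrict (h : dual Y) : exists g : dual Z, forall z, g z = h (T z).
Proof.
apply: (@bounded_linear_dual _ _ (h \o T) (`|h| * C)) => [a x y|z] /=.
  by rewrite !linearP.
by rewrite (le_trans (dual_apply_le _ _)) // -mulrA ler_wpM2l.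
Qed.

(** The adjoint of an isomorphic embedding is onto: on the range of T, the
    functional g is dominated by a multiple of the norm of Y. *)
Lemma dual_extend (g : dual Z) : exists h : dual Y, forall z, h (T z) = g z.
Proof.
pose p (y : Y) := c^-1 * `|g| * `|y|.
have p_ge0 : 0 <= c^-1 * `|g| by rewrite mulr_ge0 ?invr_ge0 // ltW.
have [x y|a x a0||f fp fT] :=
  @hahn_banach _ _ p _ _ [set (T z, g z) | z in [set: Z]].
- by rewrite -mulrDr ler_wpM2l // ler_normD.
- by rewrite /p normrZ ger0_norm // mulrCA.
- split.
  + by exists 0 => //; rewrite !linear0.
  + by move=> a _ _ [x _ <-] [y _ <-]; exists (a *: x + y); rewrite ?linearP.
  + move=> _ [z _ <-] /=; apply: le_trans (ler_norm _) _.
    apply: le_trans (dual_apply_le _ _) _.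
    by rewrite /p mulrAC mulrC ler_wpM2r // ler_pdivlMl.
have [y|h hf] := @bounded_linear_dual _ _ f (c^-1 * `|g|) (@linearP _ _ _ _ f).
  by rewrite ler_norml fp andbT lerNl -linearN (le_trans (fp _)) // /p normrN.
by exists h => z; rewrite hf; apply: (fT (T z, g z)); exists z.
Qed.

(** If y stays at distance at least e from the range, then the functional
    T z + t y |-> t e is dominated by the norm, and its extension vanishes on
    the range without vanishing at y. *)
Lemma range_separated (y : Y) :
  (forall h : dual Y, (forall z, h (T z) = 0) -> h y = 0) ->
  forall e : R, 0 < e -> exists z, `|y - T z| < e.
Proof.
move=> yT e e0; apply: contrapT => /forallNP nz.
have far z : e <= `|y + T z|.
  by have /negP := nz (- z); rewrite linearN opprK -leNgt.
have [x x'|a x a0||f fp fG] := @hahn_banach _ _ (fun y : Y => `|y|) _ _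
    [set (T w.1 + w.2 *: y, w.2 * e) | w in [set: Z * R]].
- exact: ler_normD.
- by rewrite normrZ ger0_norm.
- split.
  + by exists (0, 0) => //=; rewrite linear0 scale0r mul0r addr0.
  + move=> a _ _ [[z t] _ <-] [[z' t'] _ <-] /=.
    exists (a *: z + z', a * t + t').
      by [].
    congr pair => /=.
      by rewrite linearP scalerDr scalerA scalerDl addrACA.
    by rewrite -[_ *: (t * e)]/(a * (t * e)); ring.
  + move=> _ [[z t] _ <-] /=; apply: le_trans (ler_norm _) _.
    rewrite normrM (gtr0_norm e0).
    have [->|t0] := eqVneq t 0; first by rewrite normr0 mul0r.
    have -> : T z + t *: y = t *: (y + T (t^-1 *: z)).
      by rewrite scalerDr linearZ /= scalerA mulfV // scale1r addrC.
    by rewrite normrZ ler_wpM2l.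
have [x|h hf] := @bounded_linear_dual _ _ f 1 (@linearP _ _ _ _ f).
  by rewrite mul1r ler_norml fp andbT lerNl -linearN (le_trans (fp _)) ?normrN.
have hT z : h (T z) = 0.
  rewrite hf; have := fG (T z + 0 *: y, 0 * e).
  by rewrite /= scale0r addr0 mul0r; apply; exists (z, 0) => //=;
    rewrite scale0r addr0 mul0r.
have fy : f y = e.
  have := fG (T 0 + 1 *: y, 1 * e).
  rewrite /= linear0 add0r scale1r mul1r; apply.
  by exists (0, 1) => //=; rewrite linear0 add0r scale1r mul1r.
by have := yT _ hT; rewrite hf fy => ee; move: e0; rewrite ee ltxx.
Qed.

(** Preimages of small balls around y form a Cauchy filter on Z. *)
Lemma range_closed (y : Y) :
  (forall e : R, 0 < e -> exists z, `|y - T z| < e) -> exists z, y = T z.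
Proof.
move=> yT.
pose F : set_system Z := filter_from [set e : R | 0 < e]
  (fun e => [set z | `|y - T z| < e]).
have FF : ProperFilter F.
  apply: filter_from_proper => [|e /= /yT[z zT]]; last by exists z.
  apply: filter_from_filter; first by exists 1 => /=.
  move=> e e' /= e0 e'0; exists (Num.min e e'); first by rewrite /= lt_min e0.
  by move=> z /=; rewrite lt_min => /andP[].
have Fc : cauchy F.
  apply/cauchy_ballP => e e0; pose d := c * (e / 2).
  have d0 : 0 < d by rewrite mulr_gt0 // divr_gt0.
  have Fd : F [set z | `|y - T z| < d] by exists d.
  exists ([set z | `|y - T z| < d], [set z | `|y - T z| < d]) => //=.
  move=> [z z'] /= [zd z'd]; rewrite -ball_normE /ball_ /=.
  rewrite -(ltr_pM2l c0); apply: le_lt_trans (cT _) _.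
  have -> : T (z - z') = (y - T z') - (y - T z).
    by rewrite linearB opprB [RHS]addrC addrA subrK.
  apply: le_lt_trans (ler_normB _ _) _.
  rewrite [ltRHS](_ : _ = d + d); first exact: ltrD.
  by rewrite /d -mulrDr -splitr.
have /cvg_ex[z Fz0] := @cauchy_cvg _ F FF Fc.
have Fz := iffLR (@cvgrPdist_lt _ _ _ F _ id z) Fz0.
exists z; apply/eqP; rewrite -subr_eq0 -normr_le0; apply/ler_addgt0Pl => e e0.
have M0 : 0 < 1 + `|C| by rewrite ltr_pwDl.
have /Fz zd : 0 < e / 2 / (1 + `|C|) by rewrite !divr_gt0.
have yd : F [set z | `|y - T z| < e / 2].
  by exists (e / 2) => //=; rewrite divr_gt0.
have [z' [/= zz' yz']] := filter_ex (filterI zd yd).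
rewrite addr0 (_ : y - T z = (y - T z') - T (z - z')); last first.
  by rewrite linearB opprB addrA subrK.
apply: le_trans (ler_normB _ _) _; rewrite [leRHS]splitr; apply: lerD.
  exact: ltW.
apply: le_trans (TC _) _; move: zz'; rewrite ltr_pdivlMr // => /ltW.
apply: le_trans; rewrite mulrC ler_wpM2l //.
by rewrite (le_trans (ler_norm C)) // lerDr.
Qed.

End Embedding.

(** * An obstruction to type (D) and to uniqueness *)

Section Obstruction.
Context {R : realType} {Z : normedModType R}.
Implicit Types (B : Z -> set (dual Z)) (w : dual Z) (phi : dual (dual Z)).

(** The functional phi separates w from the range of B, on whose graph the
    duality pairing is the square of w. *)
Definition obstruction B w phi : Prop :=
  phi w = 1 /\ forall z zs, B z zs -> zs z = w z ^+ 2 /\ phi zs = 0.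

(** The pairing is the quadratic (w z - m)^2 + m (2 k - m). *)
Lemma obstruction_related B w phi (k m : R) : obstruction B w phi ->
  0 <= m -> m <= 2 * k -> forall z zs, B z zs ->
  0 <= (bidual_emb z - k *: phi) (zs - (2 * m) *: w).
Proof.
move=> [phiw Bw] m0 mk z zs /Bw[zsz phizs].
rewrite dual_subE bidual_embE dual_scaleE dual_funB dual_funZ phiw phizs.
rewrite dual_subE dual_scaleE zsz.
have -> : w z ^+ 2 - 2 * m * w z - k * (0 - 2 * m * 1) =
  (w z - m) ^+ 2 + m * (2 * k - m) by ring.
by rewrite addr_ge0 ?sqr_ge0 // mulr_ge0 // subr_ge0.
Qed.

(** Along a net that converges to (phi, 2 w), the values of phi on the second
    components are all 0, but phi (2 w) = 2. *)
Lemma obstruction_not_typeD B w phi : obstruction B w phi -> ~ typeD B.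
Proof.
move=> ob BD.
have [|I [le [a [as_ [[[i0] lexx letr ledir] Bas _ _ cvgas]]]]] :=
  (* k = m = 1 *)
  BD (1 *: phi) ((2 * 1) *: w).
  apply/ereal_infP => _ [[z zs] /= Bz <-]; rewrite lee_fin.
  by apply: obstruction_related Bz => //; lra.
have [phiw Bw] := ob.
have FF : ProperFilter (tails le).
  split; first by move=> [i /(_ i (lexx i))].
  split; first by exists i0.
    move=> P Q [i Pi] [j Qj]; have [k [ik jk]] := ledir i j.
    by exists k => l kl; split; [apply: Pi|apply: Qj]; exact: letr kl.
  by move=> P Q PQ [i Pi]; exists i => j /Pi /PQ.
have : phi (as_ t) @[t --> tails le] --> phi ((2 * 1) *: w).
  by apply: continuous_cvg => //; exact: dual_continuous.
have -> : (fun t => phi (as_ t)) = cst 0.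
  by apply/funext => t; have [_] := Bw _ _ (Bas t).
move=> /(cvg_unique _ (cvg_cst (0 : R^o)))-/(_ (@norm_hausdorff _ _)).
rewrite dual_funZ phiw => /eqP.
by rewrite !mulr1 eq_sym pnatr_eq0.
Qed.

Lemma obstruction_extension B w phi (k m : R) :
  maximally_monotone B -> obstruction B w phi -> 0 <= m -> m <= 2 * k ->
  exists C : set (dual (dual Z) * dual Z),
    [/\ maximal_monotone_set (fun (zss : dual (dual Z)) zs => zss zs) C,
        forall x xs, gra B (x, xs) -> C (bidual_emb x, xs)
      & C (k *: phi, (2 * m) *: w)].
Proof.
move=> [mB _] ob m0 mk; have rel := obstruction_related ob m0 mk.
pose pt : dual (dual Z) * dual Z := (k *: phi, (2 * m) *: w).
pose G := [set p | exists2 q, gra B q & p = (bidual_emb q.1, q.2)] `|` [set pt].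
have [p q|C mC GC] := @monotone_maximal_extension _ _ _
    (fun (zss : dual (dual Z)) zs => zss zs) G.
  move=> [[[x xs] Bx ->]|->] [[[y ys] By ->]|->]; cbn [fst snd pt].
  - by rewrite dual_subE !bidual_embE -dual_funB; exact: mB _ _ Bx By.
  - exact: rel.
  - by rewrite -opprB -[(_ - ys)]opprB dual_funN opprK; exact: rel.
  - by rewrite subrr.
by exists C; split=> // [x xs Bx|]; apply: GC; [left; exists (x, xs)|right].
Qed.

(** The extensions that contain (2 phi, 2 w) and (phi, 4 w) differ, because
    the pairing of the difference (phi, - 2 w) is negative. *)
Lemma obstruction_not_unique B w phi :
  maximally_monotone B -> obstruction B w phi -> ~ unique_op B.
Proof.
move=> mB ob Bu; have [phiw _] := ob.
have [||C1 [mC1 BC1 C1p]] := @obstruction_extension B w phi 2 1 mB ob; try lra.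
have [||C2 [mC2 BC2 C2p]] := @obstruction_extension B w phi 1 2 mB ob; try lra.
rewrite (Bu C1 C2) // in C1p.
have := mC2.1 _ _ C1p C2p; cbn [fst snd].
by rewrite -!scalerBl dual_scaleE dual_funZ phiw; lra.
Qed.

End Obstruction.

Section Transfer.
Context {R : realType} {Z : completeNormedModType R} {Y : normedModType R}.
Variables (T : {linear Z -> Y}) (c C : R).
Hypotheses (c0 : 0 < c) (cT : forall z, c * `|z| <= `|T z|)
  (TC : forall z, `|T z| <= C * `|z|).

(** The composition of B with the inverse of T on one side and the inverse of
    the adjoint of T on the other. *)
Definition transport_op (B : Z -> set (dual Z)) : Y -> set (dual Y) :=
  fun y => [set ys | exists z zs,
    [/\ y = T z, B z zs & forall x, ys (T x) = zs x]].

(** Functionals that vanish on the range of T can be added to any value of the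
    operator, so a related point (y, ys) has its first component annihilated by
    all of them; y is then T z0, and the restriction of ys to the range belongs
    to B z0 by maximality of B. *)
Lemma transport_op_maximally_monotone B :
  maximally_monotone B -> maximally_monotone (transport_op B).
Proof.
move=> [mB maxB]; split.
  move=> [x xs] [y ys] [z [zs [xE Bz zsE]]] [z' [zs' [yE Bz' zsE']]].
  cbn [fst snd] in *; rewrite xE yE -(linearB T) dual_subE zsE zsE' -dual_subE.
  exact: mB (z, zs) (z', zs') Bz Bz'.
move=> H mH BH; apply/seteqP; split=> // -[y ys] Hy.
have related z zs (hs : dual Y) : B z zs -> (forall x, hs (T x) = zs x) ->
    0 <= (ys - hs) (y - T z).
  move=> Bz hsE; apply: mH (y, ys) (T z, hs) Hy _.
  by apply: BH; exists z, zs.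
have y_range : exists z, y = T z.
  have [[z1 zs1] Bz1] : gra B !=set0.
    apply/set0P/eqP => B0.
    have : [set 0] = gra B.
      by apply: maxB => [_ _ -> ->|]; rewrite ?subrr // B0.
    by rewrite B0 => /seteqP[/(_ 0 erefl)].
  have [hs1 hsE1] := dual_extend c0 cT zs1.
  apply: range_closed c0 cT TC _ _ => e e0.
  apply: range_separated e0 => h hT; apply/eqP/contraT => hy.
  (* The slope that makes the pairing equal to -1. *)
  pose t : R := ((ys - hs1) (y - T z1) + 1) / h y.
  have := related _ _ (hs1 + t *: h) Bz1 _.
  rewrite opprD addrA dual_subE dual_scaleE (dual_funB h) hT subr0 divfK //.
  rewrite opprD addrA subrr add0r oppr_ge0 ler10; apply.
  by move=> x; rewrite dual_addE dual_scaleE hT mulr0 addr0.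
have [z0 y0] := y_range; have [zs0 zsE0] := dual_restrict TC ys.
exists z0, zs0; split=> //.
rewrite -[B z0 zs0]/(gra B (z0, zs0)).
rewrite -(maxB (gra B `|` [set (z0, zs0)])); [by right| |by left].
have rel z zs : B z zs -> 0 <= (zs0 - zs) (z0 - z).
  move=> Bz; have [hs hsE] := dual_extend c0 cT zs.
  have := related _ _ _ Bz hsE.
  by rewrite y0 -(linearB T) !dual_subE hsE zsE0.
move=> [x xs] [x' xs'] [Bx|[-> ->]] [Bx'|[-> ->]]; cbn [fst snd].
- exact: mB _ _ Bx Bx'.
- by rewrite -[xs - _]opprB -[x - _]opprB dual_funN dual_oppE opprK; exact: rel.
- exact: rel.
- by rewrite subrr.
Qed.

(** The functional phi' is phi composed with the adjoint r of T, and w' is any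
    extension of w. *)
Lemma transport_op_obstruction B w phi : obstruction B w phi ->
  exists w' phi', obstruction (transport_op B) w' phi'.
Proof.
move=> [phiw Bw]; have [w' wE] := dual_extend c0 cT w.
have [r rE] := choice (dual_restrict TC).
have rZ a h g : r (a *: h + g) = a *: r h + r g.
  by apply: dualP => z; rewrite rE dual_addE dual_scaleE -!rE.
have rw (h : dual Y) (g : dual Z) : (forall x, h (T x) = g x) -> r h = g.
  by move=> hg; apply: dualP => z; rewrite rE hg.
have [a h g|h|phi' phiE] := @bounded_linear_dual _ _ (phi \o r) (`|phi| * `|C|).
- by rewrite /= rZ dual_funD dual_funZ.
- rewrite /=; apply: le_trans (dual_apply_le _ _) _.
  rewrite -mulrA ler_wpM2l // dual_norm_le_bound ?mulr_ge0 // => x.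
  rewrite rE mulrAC; apply: le_trans (dual_apply_le _ _) _.
  rewrite mulrC ler_wpM2r //; apply: le_trans (TC x) _.
  by rewrite ler_wpM2r // ler_norm.
exists w', phi'; split; first by rewrite phiE /= (rw _ _ wE).
move=> _ ys [z [zs [-> Bz ysE]]]; have [zsz phizs] := Bw _ _ Bz.
by rewrite ysE wE zsz phiE /= (rw _ _ ysE).
Qed.

End Transfer.

Theorem copy_not_typeD (R : realType) (Z : completeNormedModType R)
    (Y : normedModType R) (B : Z -> set (dual Z)) w phi :
  maximally_monotone B -> obstruction B w phi ->
  contains_copy Z Y -> ~ typeD_space Y.
Proof.
move=> mB ob [T [c [C [c0 cTC]]]] YD.
have cT z : c * `|z| <= `|T z| by have [] := cTC z.
have TC z : `|T z| <= C * `|z| by have [] := cTC z.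
have [w' [phi' ob']] := transport_op_obstruction c0 cT TC ob.
have mB' := transport_op_maximally_monotone c0 cT TC mB.
exact: obstruction_not_typeD ob' (YD _ mB').
Qed.

(** * Weak-star cluster points *)

Lemma ultra_cvg_bounded (R : realType) (T : Type) (G : set_system T)
    (u : T -> R) (M : R) : UltraFilter G -> (forall t, `|u t| <= M) ->
  exists l : R, u @ G --> l.
Proof.
move=> GU uM; have GF := @ultra_proper _ _ GU.
have [|l [_ lcl]] := @segment_compact R (- M) M (u @ G) _.
  apply: (@filterS _ G _ setT) filterT => t _ /=.
  by rewrite in_itv /= -ler_norml.
exists l => V lV; have [//|GV] := in_ultra_setVsetC (u @^-1` V) GU.
by have [t []] := lcl (~` V) V GV lV.
Qed.

Lemma seq_cvg_unique (R : realType) (u : nat -> R) (a b : R) :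
  u @ \oo --> a -> u @ \oo --> b -> a = b.
Proof. by apply: cvg_unique; exact: norm_hausdorff. Qed.

(** Limits along an ultrafilter exist for all bounded real sequences and are
    linear; they produce a functional without any convergence of f (u n). *)
Lemma weakstar_cluster_point (R : realType) (E : normedModType R)
    (u : nat -> E) (M : R) : (forall n, `|u n| <= M) ->
  exists phi : dual (dual E),
    forall (f : dual E) (l : R), f (u n) @[n --> \oo] --> l -> phi f = l.
Proof.
move=> uM; have [G [GU ooG]] := @ultraFilterLemma nat \oo _.
have GF := @ultra_proper _ _ GU.
have fM (f : dual E) n : `|f (u n)| <= M * `|f|.
  by apply: le_trans (dual_apply_le _ _) _; rewrite mulrC ler_wpM2r.
have [phi phiP] := choice (fun f => ultra_cvg_bounded GU (fM f)).
have phi_eq (f : dual E) (l : R) : f (u n) @[n --> G] --> l -> phi f = l.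
  by move=> fl; apply: cvg_unique (phiP f) fl; exact: norm_hausdorff.
have [||g gE] := @bounded_linear_dual _ _ (phi : dual E -> R^o) M.
- move=> a f g; apply: phi_eq.
  by apply: cvgD; [apply: cvgMr; exact: phiP|exact: phiP].
- by move=> f; apply: cvgr_to_le (cvg_norm (phiP f)) _; exact: nearW.
exists g => f l fl; rewrite gE; apply: phi_eq.
exact: cvg_trans (cvg_app _ ooG) fl.
Qed.

(** * Shrinking bases *)

Section Basis.
Context {R : realType} {X : completeNormedModType R}.
Variables (e : nat -> X) (es : nat -> dual X).
Hypothesis basis : schauder_basis e es.

Lemma biorthogonal i j : es j (e i) = (i == j)%:R.
Proof. by case: basis => _. Qed.

Lemma basis_expansion x : \sum_(i < k) es i x *: e i @[k --> \oo] --> x.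
Proof.
have [/(_ x)[c _] _] := basis; move: c; rewrite /series /=.
by under eq_fun do rewrite big_mkord.
Qed.

Lemma basis_constant :
  exists2 K : R, 0 <= K &
    forall k x, `|\sum_(i < k) es i x *: e i| <= K * `|x|.
Proof.
pose P k x := \sum_(i < k) es i x *: e i.
have lP k : linear (P k).
  move=> a x y; rewrite /P scaler_sumr -big_split; apply: eq_bigr => i _ /=.
  by rewrite dual_funD dual_funZ scalerDl scalerA.
have [_ [k _ <-]|x|K PK] := @Banach_Steinhauss _ _ _ (range P) _ _ 1.
- split=> // r; exists (\sum_(i < k) `|es i| * r * `|e i|) => x xr.
  apply: le_trans (ler_norm_sum _ _ _) _; apply: ler_sum => i _.
  rewrite normrZ ler_wpM2r //; apply: le_trans (dual_apply_le _ _) _.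
  by rewrite ler_wpM2l.
- have /cvg_seq_bounded/pinfty_ex_gt0[M _ /= PM] : cvgn (P ^~ x).
    by apply/cvg_ex; exists x; exact: basis_expansion.
  by exists M => _ [k _ <-]; exact: PM.
have {}PK k x : `|x| <= 1 -> `|P k x| <= K.
  by move=> x1; apply: PK => //; exists k.
exists K => [|k x].
  by apply: le_trans (PK 0%N 0 _); rewrite ?normr0.
have [->|x0] := eqVneq x 0.
  by rewrite big1 ?normr0 ?mulr0 // => i _; rewrite linear0 scale0r.
have n0 : 0 < `|x| by rewrite normr_gt0.
have := PK k (`|x|^-1 *: x); rewrite normfZV // => /(_ (lexx _)).
have -> : P k (`|x|^-1 *: x) = `|x|^-1 *: P k x.
  rewrite /P scaler_sumr; apply: eq_bigr => i _.
  by rewrite dual_funZ scalerA.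
by rewrite normrZ normfV normr_id ler_pdivrMl // mulrC.
Qed.

Lemma coord_partial_sum i n : es i (\sum_(j < n) e j) = (i < n)%:R.
Proof.
rewrite dual_fun_sum; under eq_bigr do rewrite biorthogonal.
case: ltnP => [ltin|lenl]; last first.
  by rewrite big1 // => j _; rewrite ltn_eqF // (leq_trans (ltn_ord j)).
rewrite (bigD1 (Ordinal ltin)) //= eqxx big1 ?addr0 // => j.
by rewrite -val_eqE /= => /negbTE->.
Qed.

Hypothesis shr : shrinking es.

(** The map f |-> sum_(i < k) f (e i) es_i is the adjoint of the k-th partial
    sum projection, hence bounded by the basis constant, and it fixes any g in
    the span of the es_i as soon as k is large; such g are dense. *)
Lemma dual_expansion (f : dual X) :
  \sum_(i < k) f (e i) *: es i @[k --> \oo] --> f.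
Proof.
have [K K0 PK] := basis_constant.
pose Q k (f : dual X) := \sum_(i < k) f (e i) *: es i.
have QK k h : `|Q k h| <= K * `|h|.
  apply: dual_norm_le_bound => [|x]; first exact: mulr_ge0.
  have -> : Q k h x = h (\sum_(i < k) es i x *: e i).
    rewrite /Q dual_sumE dual_fun_sum; apply: eq_bigr => i _.
    by rewrite dual_scaleE dual_funZ mulrC.
  apply: le_trans (dual_apply_le _ _) _.
  by rewrite mulrC mulrAC ler_wpM2r.
apply/cvgrPdist_le => eps eps0.
have K1 : 0 < 1 + K by rewrite ltr_wpDr.
have : closure (lin_span es) f by rewrite shr.
move=> /(_ (ball f (eps / (1 + K)))) [].
  by apply: nbhsx_ballx; exact: divr_gt0.
move=> g [[n [c gE]]]; rewrite -ball_normE /ball_ /= => fg.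
have Qg k : (n <= k)%N -> Q k g = g.
  move=> nk; have ge i : (i < k)%N -> g (e i) = if (i < n)%N then c i else 0.
    move=> ik; rewrite gE dual_sumE.
    under eq_bigr do rewrite dual_scaleE biorthogonal.
    case: ltnP => ni; last first.
      rewrite big1 // => j _; rewrite gtn_eqF ?mulr0 //.
      exact: leq_trans (ltn_ord j) ni.
    rewrite (bigD1 (Ordinal ni)) //= eqxx mulr1 big1 ?addr0 // => j.
    by rewrite -val_eqE /= eq_sym => /negbTE->; rewrite mulr0.
  rewrite /Q [RHS]gE (big_ord_widen k (fun i => c i *: es i) nk).
  rewrite [RHS]big_mkcond /=; apply: eq_bigr => i _.
  by rewrite ge //; case: ifP => // _; rewrite scale0r.
near=> k.
have nk : (n <= k)%N by near: k; exact: nbhs_infty_ge.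
have -> : f - Q k f = (f - g) - Q k (f - g).
  have -> : Q k (f - g) = Q k f - g.
    rewrite -[in RHS](Qg k nk) /Q -sumrB; apply: eq_bigr => i _.
    by rewrite -scalerBl.
  by rewrite opprB addrA subrK.
apply: le_trans (ler_normB _ _) _.
apply: le_trans (_ : (1 + K) * `|f - g| <= _).
  by rewrite mulrDl mul1r lerD2l.
by rewrite mulrC -ler_pdivlMr // ltW.
Unshelve. all: by end_near. Qed.

Lemma bidual_expansion (phi : dual (dual X)) (f : dual X) :
  \sum_(i < k) f (e i) * phi (es i) @[k --> \oo] --> (phi f : R).
Proof.
have : phi (\sum_(i < k) f (e i) *: es i) @[k --> \oo] --> phi f.
  by apply: continuous_cvg; [exact: dual_continuous|exact: dual_expansion].
under eq_fun do rewrite dual_fun_sum.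
by under eq_fun do under eq_bigr do rewrite dual_funZ.
Qed.

Lemma bidual_ext (phi psi : dual (dual X)) :
  (forall n, phi (es n) = psi (es n)) -> phi = psi.
Proof.
move=> pp; apply: dualP => f.
have := @bidual_expansion phi f; under eq_fun do under eq_bigr do rewrite pp.
by move=> /seq_cvg_unique; apply; exact: bidual_expansion.
Qed.

(** On the dense span of the es_i the values at the partial sums are eventually
    constant; boundedness carries the convergence to the closure. *)
Lemma partial_sums_weakstar_cvg (M : R) :
  (forall n, `|\sum_(i < n) e i| <= M) ->
  exists phi : dual (dual X),
    weakstar_cvg (fun n => bidual_emb (\sum_(i < n) e i)) \oo phi.
Proof.
move=> sM; have [phi phiE] := weakstar_cluster_point sM.
have M0 : 0 <= M := le_trans (normr_ge0 _) (sM 0%N).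
have phi1 i : phi (es i) = 1.
  apply: phiE; apply: cvg_near_cst; near=> n.
  rewrite coord_partial_sum (_ : (i < n)%N) //; near: n.
  exact: nbhs_infty_gt.
exists phi => f; apply/cvgrPdist_le => eps eps0.
pose d := eps / (`|phi| + M + 1).
have dpos : 0 < `|phi| + M + 1 by rewrite ltr_wpDl // addr_ge0.
have d0 : 0 < d by rewrite divr_gt0.
have /cvgrPdist_le/(_ d d0)[k _ /(_ k (leqnn k))] := @dual_expansion f.
set g := \sum_(i < k) _ => fg.
have gs n : (k <= n)%N -> g (\sum_(i < n) e i) = phi g.
  move=> kn; rewrite dual_sumE dual_fun_sum; apply: eq_bigr => i _.
  by rewrite dual_scaleE dual_funZ phi1 coord_partial_sum (leq_trans _ kn).
near=> n; rewrite bidual_embE.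
have -> : phi f - f (\sum_(i < n) e i) =
    phi (f - g) - (f - g) (\sum_(i < n) e i).
  rewrite dual_funB dual_subE gs; first by ring.
  by near: n; exact: nbhs_infty_ge.
apply: le_trans (ler_normB _ _) _.
apply: le_trans (_ : `|phi| * d + d * M <= _).
  apply: lerD; apply: le_trans (dual_apply_le _ _) _.
    by rewrite ler_wpM2l.
  by apply: ler_pM.
have -> : eps = d * (`|phi| + M + 1) by rewrite divfK // gt_eqF.
by rewrite mulrC -mulrDr ler_wpM2l ?(ltW d0) // lerDl.
Unshelve. all: by end_near. Qed.

End Basis.

(** * The skew operator of a shrinking basis *)

Lemma affine_bounded_below (R : realType) (a b m : R) :
  (forall t, m <= a - t * b) -> b = 0.
Proof.
move=> ab; apply/eqP/contraT => b0.
by have := ab ((a - m + 1) / b); rewrite divfK //; lra.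
Qed.

Section SkewOperator.
Context {R : realType} {X : completeNormedModType R}.
Variables (e : nat -> X) (es : nat -> dual X) (ebar : dual (dual X)).
Hypotheses (basis : schauder_basis e es) (shr : shrinking es).
Hypothesis ecvg :
  weakstar_cvg (fun n => bidual_emb (\sum_(i < n) e i)) \oo ebar.

Let s n := \sum_(i < n) e i.
Let A := skew_op e.
Let D := add_op A (rank_one_op ebar).

Lemma partial_sums_cvg (y : dual X) : y (s n) @[n --> \oo] --> (ebar y : R).
Proof. exact: ecvg y. Qed.

Lemma limit_functional_coord i : ebar (es i) = 1.
Proof.
apply: seq_cvg_unique (@partial_sums_cvg (es i)) _.
apply: cvg_near_cst; near=> n; rewrite (coord_partial_sum basis).
by rewrite (_ : (i < n)%N) //; near: n; exact: nbhs_infty_gt.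
Unshelve. all: by end_near. Qed.

Lemma skew_coefE (y : dual X) n :
  skew_coef e y n = ebar y - y (s n.+1) - y (s n).
Proof.
rewrite /skew_coef -dual_fun_sum; congr (_ - _); apply/cvg_lim => //.
have c : y (s m) - y (s n.+1) @[m --> \oo] --> (ebar y - y (s n.+1) : R).
  by apply: cvgB; [exact: partial_sums_cvg|exact: cvg_cst].
apply: cvg_trans c; apply: near_eq_cvg; near=> m.
have nm : (n.+1 <= m)%N by near: m; exact: nbhs_infty_ge.
rewrite /s !dual_fun_sum -!(big_mkord predT (fun i => y (e i))).
by rewrite (big_cat_nat _ nm) //= addrAC subrr add0r.
Unshelve. all: by end_near. Qed.

(** The weak-star convergence in the definition of A amounts to an equality of
    coordinates, by the expansion of bidual elements in a shrinking basis. *)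
Lemma skew_opP (y : dual X) (yss : dual (dual X)) :
  A y yss <-> forall n, yss (es n) = skew_coef e y n.
Proof.
split=> [Ay n|yE f].
  apply: seq_cvg_unique (Ay (es n)) _.
  apply: cvg_near_cst; near=> k.
  have nk : (n < k)%N by near: k; exact: nbhs_infty_gt.
  rewrite bidual_embE dual_fun_sum (bigD1 (Ordinal nk)) //=.
  rewrite dual_funZ (biorthogonal basis) eqxx mulr1 big1 ?addr0 // => i.
  rewrite dual_funZ (biorthogonal basis) -val_eqE /= => /negbTE->.
  by rewrite mulr0.
have := @bidual_expansion _ _ _ _ basis shr yss f.
under eq_fun do under eq_bigr do rewrite yE mulrC.
by under [X in _ -> X @ _ --> _]eq_fun do
  (rewrite bidual_embE dual_fun_sum; under eq_bigr do rewrite dual_funZ).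
Unshelve. all: by end_near. Qed.

Lemma skew_op_linear : linear_relation A.
Proof.
split=> [|c [x xs] [y ys] /skew_opP Ax /skew_opP Ay].
  apply/skew_opP => n; rewrite skew_coefE !dual_zeroE; lra.
apply/skew_opP => n.
have := Ax n; have := Ay n; rewrite !skew_coefE => ys_n xs_n.
change ((c *: xs + ys) (es n) =
  ebar (c *: x + y) - (c *: x + y) (s n.+1) - (c *: x + y) (s n)).
by rewrite !dual_addE !dual_scaleE dual_funD dual_funZ xs_n ys_n; ring.
Qed.

(** Telescoping: y (e k) = y (s k.+1) - y (s k), so that the k-th partial sum of
    the pairing is ebar y * y (s k) - y (s k) ^+ 2. *)
Lemma skew_op_skew : skew_relation A.
Proof.
move=> y yss /skew_opP yE; have := @bidual_expansion _ _ _ _ basis shr yss y.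
have -> : (fun k => \sum_(i < k) y (e i) * yss (es i)) =
    (fun k => ebar y * y (s k) - y (s k) ^+ 2).
  apply/funext; elim=> [|k IH].
    by rewrite /s !big_ord0 dual_fun0; ring.
  rewrite big_ord_recr /= IH yE skew_coefE.
  by rewrite /s big_ord_recr /= dual_funD; ring.
move=> /seq_cvg_unique; apply.
rewrite [X in _ --> X](_ : _ = ebar y * ebar y - ebar y * ebar y); last by lra.
under eq_fun do rewrite expr2.
by apply: cvgB; apply: cvgM; (exact: partial_sums_cvg || exact: cvg_cst).
Qed.

(** These pairs determine A: their first components span a dense subspace. *)
Lemma skew_op_coord j : A (es j) (bidual_emb (s j + s j.+1) - ebar).
Proof.
apply/skew_opP => n; rewrite skew_coefE dual_subE bidual_embE dual_funD.
rewrite !limit_functional_coord !(coord_partial_sum basis) !ltnS.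
by case: (ltngtP n j) => _ /=; lra.
Qed.

Lemma skew_op_orthogonal (z : dual X) (zss : dual (dual X)) :
  (forall y yss, A y yss -> zss y + yss z = 0) -> A z zss.
Proof.
move=> zA; apply/skew_opP => j; have := zA _ _ (@skew_op_coord j).
by rewrite skew_coefE dual_subE bidual_embE dual_funD; lra.
Qed.

Lemma skew_op_subZ t y yss z zss :
  A y yss -> A z zss -> A (z - t *: y) (zss - t *: yss).
Proof.
move=> Ay Az; have := skew_op_linear.2 (- t) (y, yss) (z, zss) Ay Az.
rewrite -[_ *: _ + _]/(- t *: y + z, - t *: yss + zss) !scaleNr.
by rewrite ![- _ + _]addrC.
Qed.

Lemma skew_op_sub y yss z zss : A y yss -> A z zss -> A (z - y) (zss - yss).
Proof.
by move=> Ay Az; have := skew_op_subZ (t := 1) Ay Az; rewrite !scale1r.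
Qed.

Lemma skew_op_scale t y yss : A y yss -> A (t *: y) (t *: yss).
Proof.
move=> Ay; have := skew_op_subZ (t := 1 - t) Ay Ay.
by rewrite !scalerBl !scale1r !subKr.
Qed.

(** Along the multiples of a pair of the graph, the pairing is affine, since A
    is skew; bounded below, it must be constant. *)
Lemma skew_op_bounded (m : R) (z : dual X) (zss : dual (dual X)) :
  (forall y yss, A y yss -> m <= (zss - yss) (z - y)) -> A z zss.
Proof.
move=> zm; apply: skew_op_orthogonal => y yss Ay.
apply: (@affine_bounded_below _ (zss z) _ m) => t.
have := zm _ _ (skew_op_scale (t := t) Ay).
by rewrite pairing_line (skew_op_skew Ay) mulr0 addr0.
Qed.

Lemma skew_op_maximally_monotone : maximally_monotone A.
Proof.
split.
  move=> [x xs] [y ys] Ax Ay; cbn [fst snd].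
  by rewrite (skew_op_skew (skew_op_sub Ay Ax)).
move=> H mH AH; apply/seteqP; split=> // -[z zss] Hz.
apply: (@skew_op_bounded 0) => y yss Ay.
exact: mH (z, zss) (y, yss) Hz (AH (y, yss) Ay).
Qed.

Lemma skew_op_typeBR : typeBR A.
Proof.
move=> x xs a b a0 b0 inf_gt; exists x, xs; rewrite !subrr !normr0; split=> //.
apply: (@skew_op_bounded (- (a * b))) => y yss Ay; rewrite -lee_fin.
by apply: le_trans (ltW inf_gt) _; apply: ereal_inf_lbound; exists (y, yss).
Qed.

Lemma rank_one_skew_opP (y : dual X) (yss : dual (dual X)) :
  D y yss <-> A y (yss - ebar y *: ebar).
Proof.
split=> [[u Au [v -> <-]]|Ay]; first by rewrite addrK.
exists (yss - ebar y *: ebar) => //; exists (ebar y *: ebar) => //.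
by rewrite subrK.
Qed.

Lemma rank_one_skew_op_pairing y yss : D y yss -> yss y = ebar y ^+ 2.
Proof.
move=> /rank_one_skew_opP /skew_op_skew.
by rewrite dual_subE dual_scaleE expr2 => /subr0_eq.
Qed.

Lemma rank_one_skew_op_monotone :
  monotone_set (fun (x : dual X) (xs : dual (dual X)) => xs x) (gra D).
Proof.
move=> [x xs] [y ys] Dx Dy; cbn [fst snd].
suff /rank_one_skew_op_pairing -> : D (x - y) (xs - ys) by exact: sqr_ge0.
move: Dx Dy => /rank_one_skew_opP Dx /rank_one_skew_opP Dy.
apply/rank_one_skew_opP; have := skew_op_sub Dy Dx; cbn [fst snd].
rewrite dual_funB scalerBl !opprB ![_ + (ebar y *: ebar - _)]addrACA.
by rewrite [- (ebar x *: ebar) - ys]addrC.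
Qed.

(** Let (z, zss) be monotonically related to the graph of D.  Along multiples of
    es n - es 0, on which ebar vanishes, the pairing is affine as for A, which
    gives the coordinates of zss up to a common constant mu; thus zss is the sum
    of mu *: ebar and a value b of A at z.  Moving from z by a multiple t of
    es 0 then yields t ^+ 2 + t * (mu - ebar z) >= 0 for all t, which forces
    mu = ebar z. *)
Lemma rank_one_skew_op_maximally_monotone : maximally_monotone D.
Proof.
split; first exact: rank_one_skew_op_monotone.
move=> H mH DH; apply/seteqP; split=> // -[z zss] Hz.
have related y a : A y a -> 0 <= (zss - (a + ebar y *: ebar)) (z - y).
  move=> Ay; apply: mH (z, zss) (y, _) Hz (DH _ _).
  by apply/rank_one_skew_opP; rewrite addrK.
pose c n := (bidual_emb (s n + s n.+1) - ebar).
have Ac n : A (es n) (c n) := @skew_op_coord n.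
pose mu := zss (es 0%N) - skew_coef e z 0.
have zE n : zss (es n) = skew_coef e z n + mu.
  have Ad : A (es n - es 0%N) (c n - c 0%N).
    exact: skew_op_sub (Ac 0%N) (Ac n).
  have : zss (es n - es 0%N) + (c n - c 0%N) z = 0.
    apply: (@affine_bounded_below _ (zss z) _ 0) => t.
    have := related _ _ (skew_op_scale (t := t) Ad).
    have -> : ebar (t *: (es n - es 0%N)) = 0.
      by rewrite dual_funZ dual_funB !limit_functional_coord subrr mulr0.
    by rewrite scale0r addr0 pairing_line (skew_op_skew Ad) mulr0 addr0.
  rewrite dual_funB /c !dual_subE !bidual_embE !dual_funD /mu !skew_coefE.
  by lra.
pose b := zss - mu *: ebar.
have Ab : A z b.
  apply/skew_opP => n; rewrite /b dual_subE dual_scaleE.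
  by rewrite limit_functional_coord zE mulr1 addrK.
have muE : mu - ebar z = 0.
  suff q t : 0 <= t ^+ 2 + t * (mu - ebar z).
    have := q (- (mu - ebar z) / 2).
    rewrite (_ : _ + _ = - ((mu - ebar z) ^+ 2 / 4)); last by field.
    rewrite oppr_ge0 => le0; apply/eqP; rewrite -sqrf_eq0.
    by rewrite eq_le sqr_ge0 andbT; lra.
  have A0 := Ac 0%N.
  have At : A (z - t *: es 0%N) (b - t *: c 0%N) by exact: skew_op_subZ A0 Ab.
  have := related _ _ At.
  rewrite subKr.
  rewrite dual_funZ dual_subE dual_addE dual_subE !dual_scaleE.
  rewrite [ebar (z - _)]dual_funB [ebar (_ *: _)]dual_funZ.
  rewrite !limit_functional_coord.
  rewrite (skew_op_skew A0) /b dual_subE dual_scaleE !limit_functional_coord.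
  by lra.
apply/rank_one_skew_opP; rewrite -/(gra D).
have <- : b = zss - ebar z *: ebar by rewrite /b (subr0_eq muE).
exact: Ab.
Qed.

(** The coordinates of a value of D tend to 0 and those of ebar are 1, so a
    cluster point of the coordinate functionals separates them. *)
Lemma rank_one_skew_op_obstruction (M : R) : (forall n, `|es n| <= M) ->
  exists phi, obstruction D ebar phi.
Proof.
move=> esM; have [phi phiE] := weakstar_cluster_point esM.
exists phi; split.
  apply: phiE; under eq_fun do rewrite limit_functional_coord.
  exact: cvg_cst.
move=> y yss Dy; split; first exact: rank_one_skew_op_pairing.
apply: phiE.
have c : ebar y - y (s n.+1) - y (s n) + ebar y @[n --> \oo] -->
    ebar y - ebar y - ebar y + ebar y.
  apply: cvgD; last exact: cvg_cst.
  apply: cvgB; last exact: partial_sums_cvg.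
  apply: cvgB; first exact: cvg_cst.
  by rewrite (cvg_shiftS (fun n => y (s n))); exact: partial_sums_cvg.
have -> : 0 = ebar y - ebar y - ebar y + ebar y by lra.
have -> // : (fun n => yss (es n) : R) =
    (fun n => ebar y - y (s n.+1) - y (s n) + ebar y).
apply/funext => n; move: Dy => /rank_one_skew_opP/skew_opP/(_ n).
rewrite dual_subE dual_scaleE limit_functional_coord skew_coefE; lra.
Qed.

End SkewOperator.

(** * The James space *)

Section Variation.
Context {R : realType}.
Implicit Types (x y : nat -> R^o) (s : seq nat).

Lemma qvar_ge0 x s : 0 <= qvar x s.
Proof. by apply: sumr_ge0 => i _; exact: sqr_ge0. Qed.

Lemma qvar_cons2 x i j s :
  qvar x [:: i, j & s] = (x i - x j) ^+ 2 + qvar x (j :: s).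
Proof. by rewrite /qvar /= big_ord_recl. Qed.

Lemma qvar1 x i : qvar x [:: i] = 0.
Proof. by rewrite /qvar big_ord0. Qed.

Lemma qvar0 x : qvar x [::] = 0.
Proof. by rewrite /qvar big_ord0. Qed.

Lemma eq_qvar x y s : {in s, x =1 y} -> qvar x s = qvar y s.
Proof.
case: s => [|i s]; first by rewrite !qvar0.
elim: s i => [|j s IH] i xy; first by rewrite !qvar1.
rewrite !qvar_cons2 IH => [|k ks]; last by apply: xy; rewrite in_cons ks orbT.
by rewrite !xy // !in_cons eqxx ?orbT.
Qed.

Lemma qvar_cat x i s j t : qvar x ((i :: s) ++ j :: t) =
  qvar x (i :: s) + (x (last i s) - x j) ^+ 2 + qvar x (j :: t).
Proof.
elim: s i => [|k s IH] i; first by rewrite /= qvar_cons2 qvar1 add0r.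
by rewrite /= qvar_cons2 -cat_cons IH qvar_cons2 !addrA.
Qed.

Lemma qvar_cat_ge x s t : qvar x s + qvar x t <= qvar x (s ++ t).
Proof.
case: s => [|i s]; first by rewrite qvar0 add0r.
case: t => [|j t]; first by rewrite qvar0 addr0 cats0.
by rewrite qvar_cat lerD2r lerDl sqr_ge0.
Qed.

(** (a - b)^2 <= 2 a^2 + 2 b^2 at the junction; the default value 0 covers the
    case of an empty list. *)
Lemma qvar_cat_le x s t : qvar x (s ++ t) <=
  qvar x s + 2 * last 0 (map x s) ^+ 2 + 2 * head 0 (map x t) ^+ 2 + qvar x t.
Proof.
case: s => [|i s].
  by rewrite qvar0 /= expr0n mulr0 !add0r lerDr mulr_ge0 ?sqr_ge0.
case: t => [|j t].
  by rewrite cats0 qvar0 /= expr0n mulr0 !addr0 lerDl mulr_ge0 ?sqr_ge0.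
rewrite qvar_cat lerD2r -addrA lerD2l /= last_map.
by rewrite -subr_ge0 (_ : _ - _ = (x (last i s) + x j) ^+ 2) ?sqr_ge0 //; ring.
Qed.

Lemma sorted_split (m : nat) s : sorted ltn s ->
  exists s1 s2, [/\ s = s1 ++ s2, sorted ltn s1, sorted ltn s2,
    forall i, i \in s1 -> (i < m)%N & forall i, i \in s2 -> (m <= i)%N].
Proof.
elim: s => [_|i s IH ss]; first by exists [::], [::].
have [im|mi] := ltnP i m.
  have [s1 [s2 [sE ss1 ss2 s1m s2m]]] := IH (path_sorted ss).
  exists (i :: s1), s2; split=> //; first by rewrite sE.
    by move: ss; rewrite /= sE cat_path => /andP[].
  by move=> j; rewrite in_cons => /predU1P[->|/s1m].
exists [::], (i :: s); split=> // j; rewrite in_cons => /predU1P[->//|js].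
have /allP/(_ _ js) := order_path_min ltn_trans ss.
by move=> /ltnW; exact: leq_trans.
Qed.

End Variation.

Section JamesSpace.
Context {R : realType}.
Implicit Types (x y : james R) (s : seq nat).

Lemma qvar_le_sqr x s : sorted ltn s -> qvar x s <= `|x| ^+ 2.
Proof.
move=> ss; rewrite -[leLHS]sqr_sqrtr ?qvar_ge0 //.
by rewrite ler_pXn2r ?nnegrE ?sqrtr_ge0 //; exact: qvar_le_norm.
Qed.

Lemma james_norm_le x (M : R) : 0 <= M ->
  (forall s, sorted ltn s -> qvar x s <= M ^+ 2) -> `|x| <= M.
Proof.
move=> M0 xM; apply: james_norm_ub => s /xM qM.
by rewrite -[leRHS]ger0_norm // -sqrtr_sqr ler_wsqrtr.
Qed.

Lemma james_sqr_coord_le x n : x n ^+ 2 <= `|x| ^+ 2.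
Proof.
rewrite -[leLHS]real_normK ?num_real // ler_pXn2r ?nnegrE //.
exact: coord_le_norm.
Qed.

Lemma sqr_head_le x s : head 0 (map x s) ^+ 2 <= `|x| ^+ 2.
Proof.
by case: s => [|i s] /=; rewrite ?expr0n ?sqr_ge0 ?james_sqr_coord_le.
Qed.

Lemma sqr_last_le x s : last 0 (map x s) ^+ 2 <= `|x| ^+ 2.
Proof.
case: s => [|i s] /=; rewrite ?expr0n ?sqr_ge0 // last_map.
exact: james_sqr_coord_le.
Qed.

Lemma james_sumE (a : nat -> R) k j :
  (\sum_(i < k) a i *: (james_unit i : james R)) j =
    if (j < k)%N then a j else 0.
Proof.
rewrite -[LHS]/(james_coord j _) dual_fun_sum.
under eq_bigr do rewrite dual_funZ -[james_coord _ _]/((j == _)%:R : R).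
case: ltnP => [jk|kj]; last first.
  by rewrite big1 // => i _; rewrite gtn_eqF ?mulr0 // (leq_trans (ltn_ord i)).
rewrite (bigD1 (Ordinal jk)) //= eqxx mulr1 big1 ?addr0 // => i.
by rewrite -val_eqE eq_sym /= => /negbTE->; rewrite mulr0.
Qed.

(** Choose a selection s0 whose variation exceeds the squared norm of x minus d.
    Beyond s0, any selection s2 can be appended to s0, so its variation is at
    most d; entering the support of the tail costs at most 2 d more, once the
    coordinates have squares at most d. *)
Lemma james_expansion x :
  \sum_(i < k) x i *: (james_unit i : james R) @[k --> \oo] --> x.
Proof.
apply/cvgrPdist_le => eps eps0.
pose d := eps ^+ 2 / 3.
have d0 : 0 < d by rewrite divr_gt0 // exprn_gt0.
have [s0 ss0 qs0] : exists2 s0, sorted ltn s0 & `|x| ^+ 2 - d < qvar x s0.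
  apply: contrapT => nos.
  have qle s : sorted ltn s -> qvar x s <= `|x| ^+ 2 - d.
    by move=> ss; rewrite leNgt; apply/negP => xs; apply: nos; exists s.
  have xd0 : 0 <= `|x| ^+ 2 - d by apply: le_trans (qvar_ge0 x [::]) (qle _ _).
  have /(_ (sqrtr_ge0 _)) := @james_norm_le x (Num.sqrt (`|x| ^+ 2 - d)).
  rewrite sqr_sqrtr // => /(_ qle).
  rewrite -(@ler_pXn2r _ 2) ?nnegrE ?sqrtr_ge0 // sqr_sqrtr //.
  by lra.
have [N _ xN] : \forall k \near \oo, `|x k| < Num.sqrt d.
  by have /cvgr0Pnorm_lt := james_cvg0 x; apply; rewrite sqrtr_gt0.
near=> k.
have s0k i : i \in s0 -> (i < k)%N.
  move=> is0; apply: (@leq_ltn_trans (\max_(j <- s0) j)).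
    exact: (@leq_bigmax_seq _ s0 predT id).
  by near: k; exact: nbhs_infty_gt.
have xk i : (k <= i)%N -> x i ^+ 2 <= d.
  move=> ki; rewrite -[leLHS]real_normK ?num_real //.
  rewrite -[leRHS](sqr_sqrtr (ltW d0)).
  rewrite ler_pXn2r ?nnegrE ?sqrtr_ge0 //; apply/ltW/xN => /=.
  by apply: leq_trans ki; near: k; exact: nbhs_infty_ge.
apply: james_norm_le (ltW eps0) _ => s ss.
have [s1 [s2 [-> ss1 ss2 s1k s2k]]] := sorted_split k ss.
set t := x - _.
have tE i : t i = if (i < k)%N then 0 else x i.
  rewrite -[t i]/(x i - (\sum_(i < k) x i *: james_unit i : james R) i).
  rewrite james_sumE.
  by case: ifP => _; rewrite ?subrr ?subr0.
clearbody t; apply: le_trans (qvar_cat_le t s1 s2) _.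
have -> : qvar t s1 = 0.
  rewrite (@eq_qvar _ t (fun=> 0)) => [|i /s1k ik]; last by rewrite tE ik.
  by rewrite /qvar big1 // => i _; rewrite subrr expr0n.
have -> : last 0 (map t s1) = 0.
  case: (s1) s1k => //= i s' s1k; rewrite last_map. rewrite tE s1k //.
  exact: mem_last.
have -> : qvar t s2 = qvar x s2.
  by apply: eq_qvar => i /s2k ki; rewrite tE ltnNge ki.
have h2 : head 0 (map t s2) ^+ 2 <= d.
  case: (s2) s2k => [|i s'] s2k /=; first by rewrite expr0n ltW.
  by rewrite tE ltnNge s2k ?mem_head //= xk // s2k // mem_head.
have q2 : qvar x s0 + qvar x s2 <= `|x| ^+ 2.
  apply: le_trans (qvar_cat_ge x s0 s2) _; apply: qvar_le_sqr.
  move: ss2 s2k; case: (s2) => [|j s'] /= ss2 s2k; first by rewrite cats0.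
  case: (s0) ss0 s0k => [//|i s''] /= ss0 s0k.
  rewrite cat_path ss0 /= ss2 andbT (leq_trans (s0k _ (mem_last _ _))) //.
  by rewrite s2k // mem_head.
rewrite expr0n mulr0 !add0r.
have dE : eps ^+ 2 = 3 * d by rewrite /d; field.
by lra.
Unshelve. all: by end_near. Qed.

Lemma james_schauder_basis :
  schauder_basis (fun n => james_unit n : james R) james_coord.
Proof.
split=> [x|i j]; last by rewrite -[LHS]/((j == i)%:R : R) eq_sym.
split=> [|a ax].
  have := @james_expansion x; rewrite /series /=.
  by under [X in _ -> X @ _ --> _]eq_fun do rewrite big_mkord.
apply/funext => n.
have c : james_coord n (series (fun m => a m *: (james_unit m : james R)) k)
    @[k --> \oo] --> james_coord n x.
  by apply: continuous_cvg ax; exact: dual_continuous.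
apply: seq_cvg_unique c _; apply: cvg_near_cst; near=> k.
have nk : (n < k)%N by near: k; exact: nbhs_infty_gt.
by rewrite /series /= big_mkord -[LHS]/((_ : james R) n) james_sumE nk.
Unshelve. all: by end_near. Qed.

(** Consecutive blocks on which f is at least eps and the norm at most L. *)
Section Blocks.
Variables (f : dual (james R)) (eps L : R).
Hypothesis block : forall m, exists (u : james R) (m' : nat),
  [/\ (m <= m')%N, forall j, (j < m)%N || (m' <= j)%N -> u j = 0,
      eps <= f u & `|u| <= L].

(** Bounding the variation together with twice the square of the last value
    makes the estimate inductive: for a selection that continues into a new
    block u, the junction costs twice the square of the last value of v, which
    is in the previous bound, and 2 L^2; the variation of u adds L^2 and the new
    last value 2 L^2. *)
Lemma block_sum N : exists (v : james R) (m : nat),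
  [/\ forall j, (m <= j)%N -> v j = 0, N%:R * eps <= f v
    & forall s, sorted ltn s ->
        qvar v s + 2 * last 0 (map v s) ^+ 2 <= N%:R * (5 * L ^+ 2)].
Proof.
elim: N => [|N [v [m [v0 fv qv]]]].
  exists 0, 0%N; split=> // [|s ss]; first by rewrite dual_fun0 mul0r.
  have := qvar_le_sqr 0 ss; have := sqr_last_le 0 s.
  by rewrite normr0 expr0n /= mul0r => h1 h2; lra.
have [u [m' [mm' u0 fu uL]]] := block m.
have uL2 : `|u| ^+ 2 <= L ^+ 2.
  by rewrite ler_pXn2r ?nnegrE // (le_trans _ uL).
exists (v + u), m'; split.
- move=> j mj; rewrite -[LHS]/(v j + u j) v0 ?(leq_trans mm') // u0 ?addr0 //.
  by rewrite mj orbT.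
- by rewrite dual_funD -natr1 mulrDl mul1r lerD.
move=> s ss; have [s1 [s2 [-> ss1 ss2 s1m s2m]]] := sorted_split m ss.
have wv : {in s1, (v + u : james R) =1 v}.
  by move=> i /s1m im; rewrite -[LHS]/(v i + u i) u0 ?im // addr0.
have wu : {in s2, (v + u : james R) =1 u}.
  by move=> i /s2m mi; rewrite -[LHS]/(v i + u i) v0 // add0r.
have := qvar_cat_le (v + u : james R) s1 s2.
rewrite (eq_qvar wv) (eq_qvar wu) map_cat.
rewrite ((eq_in_map _ _ _).1 wv) ((eq_in_map _ _ _).1 wu).
have qs1 := qv _ ss1; have qs2 := qvar_le_sqr u ss2.
have hd := sqr_head_le u s2; have ls := sqr_last_le u s2.
have NE : N.+1%:R = N%:R + 1 :> R by rewrite natr1.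
case: (s2) hd ls qs2 => [|j s'] /= hd ls qs2.
  rewrite !cats0 (eq_qvar wv) NE => _.
  have : 0 <= `|u| ^+ 2 by exact: sqr_ge0.
  by lra.
rewrite last_cat /= NE => q.
by lra.
Qed.

(** The sum v of N blocks has f v >= N eps and norm at most sqrt (5 N) L, hence
    N eps^2 <= 5 |f|^2 L^2 for every N. *)
Lemma no_blocks : 0 < eps -> False.
Proof.
move=> eps0.
have L2 : 0 <= 5 * L ^+ 2 by rewrite mulr_ge0 ?sqr_ge0.
have bound N : N%:R * eps ^+ 2 <= `|f| ^+ 2 * (5 * L ^+ 2).
  have [->|N0] := posnP N; first by rewrite mul0r mulr_ge0 // sqr_ge0.
  have [v [m [_ fv qv]]] := block_sum N.
  have vN : `|v| ^+ 2 <= N%:R * (5 * L ^+ 2).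
    have NL : 0 <= N%:R * (5 * L ^+ 2) by rewrite mulr_ge0.
    rewrite -[leRHS](sqr_sqrtr NL) ler_pXn2r ?nnegrE ?sqrtr_ge0 //.
    apply: james_norm_le => [|s ss]; rewrite ?sqrtr_ge0 // sqr_sqrtr //.
    by apply: le_trans (qv _ ss); rewrite lerDl mulr_ge0 ?sqr_ge0.
  have Np : 0 < N%:R :> R by rewrite ltr0n.
  suff : N%:R * (N%:R * eps ^+ 2) <= N%:R * (`|f| ^+ 2 * (5 * L ^+ 2)).
    by rewrite ler_pM2l.
  rewrite mulrA -expr2 -exprMn mulrCA.
  apply: le_trans (_ : (`|f| * `|v|) ^+ 2 <= _).
    rewrite ler_pXn2r ?nnegrE ?mulr_ge0 // ?(ltW eps0) //.
    by apply: le_trans fv _; apply: le_trans (ler_norm _) (dual_apply_le _ _).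
  by rewrite exprMn ler_wpM2l ?sqr_ge0.
pose c := `|f| ^+ 2 * (5 * L ^+ 2) / eps ^+ 2.
have e2 : 0 < eps ^+ 2 by rewrite exprn_gt0.
have := bound (Num.truncn c).+1; rewrite -ler_pdivlMr // -/c.
by rewrite leNgt truncnS_gt.
Qed.

End Blocks.

(** If f has distance at least d from the span of the coordinate functionals,
    then beyond every index m it exceeds d / 2 on the tail of some x of the unit
    ball, hence d / 3 on a finite part of this tail; these parts are blocks. *)
Lemma james_shrinking : shrinking (@james_coord R).
Proof.
apply/seteqP; split=> // f _; apply: contrapT => nf.
have [d d0 far] : exists2 d : R, 0 < d &
    forall g, lin_span james_coord g -> d <= `|f - g|.
  apply: contrapT => nd; apply: nf => B /nbhs_ballP[d /= d0 dB].
  apply: contrapT => ndB; apply: nd; exists d => // g gs.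
  rewrite leNgt; apply/negP => fg; apply: ndB; exists g; split=> //.
  by apply: dB; rewrite -ball_normE.
have [K K0 PK] := basis_constant james_schauder_basis.
pose P k x := \sum_(i < k) x i *: (james_unit i : james R).
have {}PK k x : `|P k x| <= K * `|x| := PK k x.
apply: (@no_blocks f (d / 3) (K + K)); last by rewrite divr_gt0.
move=> m.
have [x x1 fx] : exists2 x, `|x| <= 1 & d / 2 < f (x - P m x).
  apply: contrapT => nx.
  pose g := \sum_(i < m) f (james_unit i) *: (james_coord i : dual (james R)).
  have gE x : (f - g) x = f (x - P m x).
    rewrite dual_subE dual_funB /g /P dual_sumE dual_fun_sum; congr (_ - _).
    by apply: eq_bigr => i _; rewrite dual_scaleE dual_funZ mulrC.
  have fle x : `|x| <= 1 -> (f - g) x <= d / 2.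
    by move=> x1; rewrite gE leNgt; apply/negP => fx; apply: nx; exists x.
  have : d <= `|f - g| by apply: far; exists m, (fun i => f (james_unit i)).
  apply/negP; rewrite -ltNge (@le_lt_trans _ _ (d / 2)) //; last by lra.
  apply: dual_norm_ub => x x1; rewrite ler_norml fle // andbT.
  by rewrite lerNl -dual_funN fle // normrN.
have c : f (P k x - P m x) @[k --> \oo] --> f (x - P m x).
  apply: continuous_cvg; first exact: dual_continuous.
  by apply: cvgB; [exact: james_expansion|exact: cvg_cst].
have [m' mm' fm'] : exists2 m', (m <= m')%N & d / 3 <= f (P m' x - P m x).
  near \oo => k; exists k; first by near: k; exact: nbhs_infty_ge.
  apply: ltW; near: k; apply: (cvgr_gt _ c).
  by apply: le_lt_trans fx; lra.
exists (P m' x - P m x), m'; split=> //.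
  move=> j jm.
  rewrite -[LHS]/((P m' x : james R) j - (P m x : james R) j) !james_sumE.
  case: (ltnP j m) jm => [jm _|_ /= m'j].
    by rewrite (leq_trans jm) ?subrr.
  by rewrite ltnNge m'j subrr.
apply: le_trans (ler_normB _ _) _; apply: lerD.
  by apply: le_trans (PK _ _) _; rewrite ler_piMr.
by apply: le_trans (PK _ _) _; rewrite ler_piMr.
Unshelve. all: by end_near. Qed.

Lemma james_coord_norm n : `|james_coord n : dual (james R)| <= 1.
Proof.
apply: dual_norm_le_bound => // x; rewrite mul1r; exact: coord_le_norm.
Qed.

Lemma james_partial_sum_norm n :
  `|\sum_(i < n) (james_unit i : james R)| <= Num.sqrt 2.
Proof.
apply: james_norm_le; first exact: sqrtr_ge0.
move=> s ss; rewrite sqr_sqrtr //.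
set u := \sum_(i < n) _.
have uE j : u j = (j < n)%:R.
  have -> : u = \sum_(i < n) 1 *: (james_unit i : james R).
    by apply: eq_bigr => i _; rewrite scale1r.
  by rewrite (james_sumE (fun=> 1)); case: ltnP.
clearbody u; have [s1 [s2 [-> _ _ s1n s2n]]] := sorted_split n ss.
have q0 (c : R) (t : seq nat) : {in t, u =1 fun=> c} -> qvar u t = 0.
  move=> /eq_qvar->; rewrite /qvar big1 // => i _.
  by rewrite subrr expr0n.
apply: le_trans (qvar_cat_le u s1 s2) _.
rewrite (q0 1) => [|i /s1n]; last by rewrite uE => ->.
rewrite (q0 0) => [|i /s2n]; last by rewrite uE ltnNge => ->.
have -> : head 0 (map u s2) = 0.
  by case: (s2) s2n => //= j t s2n; rewrite uE ltnNge s2n // mem_head.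
have : last 0 (map u s1) ^+ 2 <= 1.
  case: (s1) s1n => [|j t] s1n /=; first by rewrite expr0n.
  by rewrite last_map uE s1n ?mem_last // expr1n.
by rewrite expr0n /= => l1; lra.
Qed.

End JamesSpace.

Theorem mainTheorem6 (R : realType) :
  (forall (X : completeNormedModType R) (e : nat -> X) (es : nat -> dual X)
      (ebar : dual (dual X)),
    schauder_basis e es ->
    shrinking es ->
    weakstar_cvg (fun n => bidual_emb (\sum_(i < n) e i)) \oo ebar ->
    [/\ maximally_monotone (skew_op e),
        linear_relation (skew_op e),
        skew_relation (skew_op e)
      & typeBR (skew_op e)])
  /\
  (exists ebar : dual (dual (james R)),
    unique (fun f : dual (dual (james R)) => forall n, f (james_coord n) = 1)
      ebar /\
    let A := skew_op (fun n => james_unit n : james R) in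
    [/\ maximally_monotone (add_op A (rank_one_op ebar)),
        ~ typeD (add_op A (rank_one_op ebar))
      & ~ unique_op (add_op A (rank_one_op ebar))])
  /\
  (forall Y : completeNormedModType R,
    contains_copy (dual (james R)) Y -> ~ typeD_space Y).
Proof.
split=> [X e es ebar basis shr ecvg|].
  split.
  - exact: skew_op_maximally_monotone basis shr ecvg.
  - exact: skew_op_linear basis shr ecvg.
  - exact: skew_op_skew basis shr ecvg.
  - exact: skew_op_typeBR basis shr ecvg.
have basis := @james_schauder_basis R; have shr := @james_shrinking R.
have [ebar ecvg] :=
  partial_sums_weakstar_cvg basis shr (@james_partial_sum_norm R).
have [phi ob] :=
  rank_one_skew_op_obstruction basis shr ecvg (@james_coord_norm R).
have mD := rank_one_skew_op_maximally_monotone basis shr ecvg.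
split; last by move=> Y; exact: copy_not_typeD mD ob.
exists ebar; split.
  split=> [n|f fE]; first exact: limit_functional_coord basis ecvg n.
  apply: (bidual_ext basis shr) => n.
  by rewrite fE (limit_functional_coord basis ecvg).
split=> //; first exact: obstruction_not_typeD ob.
exact: obstruction_not_unique mD ob.
Qed.
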